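(* For any $\mathcal S\subseteq L^1$, the following are equivalent. (i) $\mathcal S$ is uniformly integrable. (ii) There exists $\rho\in\mathcal R$ such that $\rho(|X|)$ is bounded for $X\in\mathcal S$. (iii) There exists $\rho\in\mathcal R$ such that $\rho(X)$ and $\rho(-X)$ are bounded for $X\in\mathcal S$. (iv) There exist $\rho,\rho'\in\mathcal R$ such that $\rho(X)$ and $\rho'(-X)$ are bounded from above for $X\in\mathcal S$.
   Context: Fix an atomless probability space $(\Omega,\mathcal F,\mathbb P)$; random variables are real-valued and almost surely equal ones are identified; $L^1$ is the set of integrable random variables. A set $\mathcal S$ of random variables is uniformly integrable if $\sup_{X\in\mathcal S}\mathbb E[|X|\mathbf 1_{\{|X|>K\}}]\to0$ as $K\to\infty$. A coherent risk measure on $L^1$ is a map $\rho:L^1\to(-\infty,\infty]$, finite on constants, satisfying monotonicity ($\rho(X)\le\rho(Y)$ if $X\le Y$), cash invariance ($\rho(X+c)=\rho(X)+c$ for $c\in\mathbb R$), convexity ($\rho(\lambda X+(1-\lambda)Y)\le\lambda\rho(X)+(1-\lambda)\rho(Y)$ for $\lambda\in(0,1)$) and positive homogeneity ($\rho(\lambda X)=\lambda\rho(X)$ for $\lambda>0$). It is law-invariant if $\rho(X)=\rho(Y)$ whenever $X$ and $Y$ have the same distribution, and lower semicontinuous if $\liminf_{n}\rho(X_n)\ge\rho(X)$ whenever $X_n\to X$ in $L^1$. It is finite on $L^1$ if $\rho(X)<\infty$ for all $X\in L^1$. $\mathcal R$ is the set of all lower semicontinuous, law-invariant coherent risk measures on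 $L^1$ that are not finite on $L^1$. ''Bounded for $X\in\mathcal S$'' means that the set of values over $X\in\mathcal S$ is a bounded subset of $\mathbb R$ (in particular finite); ''bounded from above'' means bounded by a finite constant. *)

(* Defs.v *)
From HB Require Import structures.
From mathcomp Require Import all_boot all_order all_algebra.
From mathcomp Require Import all_classical all_reals all_analysis.
Import Order.TTheory GRing.Theory Num.Theory.
Import numFieldNormedType.Exports.

Set Implicit Arguments.
Unset Strict Implicit.
Unset Printing Implicit Defensive.

Local Open Scope classical_set_scope.
Local Open Scope ring_scope.
Local Open Scope ereal_scope.

(* Integrable random variables.  Almost surely equal elements are not
   quotiented: [rm_mono] is stated with almost sure inequality, which forces a
   risk measure to agree on almost surely equal variables. *)
Notation L1 P := (LfunType P (@lexx _ _ 1%E)).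

Section risk_measures.
Context (d : measure_display) (T : measurableType d) (R : realType).
Variable P : probability T R.
Implicit Types (X Y : L1 P) (rho : L1 P -> \bar R) (S : set (L1 P)).

Definition atomless := forall A, measurable A -> 0 < P A ->
  exists B, [/\ measurable B, B `<=` A, 0 < P B & P B < P A].

Definition L1_cst (c : R) : L1 P := Lfun_Sub (@lexx _ _ 1) (Lfun_cst P c 1).

Definition L1_abs X : L1 P := Lfun_Sub (@lexx _ _ 1) (Lfun_norm (LfunP X)).

(* The added 0 only matters for empty S: the supremum is taken in [0, +oo],
   whereas [ereal_sup set0] is -oo. *)
Definition uniformly_integrable S :=
  ereal_sup (0 |` [set 'E_P[fun w => (`|X w| * \1_[set v | K < `|X v|] w)%R]
                  | X in S]) @[K --> +oo%R] --> 0.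

Record coherent_risk_measure rho : Prop := {
  rm_gtNy : forall X, -oo < rho X ;
  rm_cst_fin : forall c, rho (L1_cst c) \is a fin_num ;
  rm_mono : forall X Y, {ae P, forall w, (X w <= Y w)%R} -> rho X <= rho Y ;
  rm_cash : forall X c, rho (X + L1_cst c)%R = rho X + c%:E ;
  rm_convex : forall X Y (l : R), (0 < l < 1)%R ->
    rho (l *: X + (1 - l) *: Y)%R <= l%:E * rho X + (1 - l)%:E * rho Y ;
  rm_homog : forall X (l : R), (0 < l)%R -> rho (l *: X)%R = l%:E * rho X }.

(* Laws are compared on Borel sets only: [distribution] also has unspecified
   values on non-measurable sets. *)
Definition same_law X Y := forall A : set R, measurable A ->
  distribution P X A = distribution P Y A.

Definition law_invariant rho := forall X Y, same_law X Y -> rho X = rho Y.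

Definition L1_cvg (Xn : nat -> L1 P) X :=
  'N[P]_1[EFin \o (Xn n - X)%R] @[n --> \oo] --> 0.

Definition lsc rho := forall (Xn : nat -> L1 P) X, L1_cvg Xn X ->
  rho X <= limn_einf (fun n => rho (Xn n)).

Definition finite_on_L1 rho := forall X, rho X < +oo.

Definition calR : set (L1 P -> \bar R) := [set rho |
  [/\ coherent_risk_measure rho, law_invariant rho, lsc rho &
      ~ finite_on_L1 rho]].

Definition bounded_over S (f : L1 P -> \bar R) :=
  exists M : R, forall X, S X -> `|f X| <= M%:E.

Definition bounded_above_over S (f : L1 P -> \bar R) :=
  exists M : R, forall X, S X -> f X <= M%:E.

End risk_measures.

(* Main.v *)
Require Import Defs.
From HB Require Import structures.
From mathcomp Require Import all_boot all_order all_algebra.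
From mathcomp Require Import all_classical all_reals all_analysis.
From mathcomp Require Import measurable_realfun zify lra ring.
Import Order.TTheory GRing.Theory Num.Theory.
Import numFieldNormedType.Exports.

Set Implicit Arguments.
Unset Strict Implicit.
Unset Printing Implicit Defensive.

Local Open Scope classical_set_scope.
Local Open Scope ring_scope.

(* From (i) to (ii): uniform integrability gives thresholds K_n >= 1 such that
   E[|X| 1_{|X| > K_n}] <= 4^-n on S.  The functional
   rho_n = (1 - a_n) E + a_n ES_{p_n}, with a_n = 1 / K_n and a_n / p_n = 4^n,
   satisfies rho_n(|X|) <= E|X| + 2 on S (take t = K_n in the
   Rockafellar-Uryasev formula for the expected shortfall), and the supremum of
   the rho_n is infinite at a suitable sum_n x_n 1_(A_n).

   From (iv) to (i): on an atomless space, averaging the rearrangements of X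
   over an equipartition of an event C and using lower semicontinuity shows that
   replacing X on C by its mean on C does not increase rho.  Consequently
   rho(1_A) / P(A) tends to infinity as P(A) tends to 0: otherwise this ratio
   would be bounded over all events, and rho finite on L^1.  Averaging X over
   A = {X > K} and over its complement gives
   rho(X) >= E[X 1_A] (rho(1_A) / P(A) - 2) - 2 M whenever E[X] >= - M and
   P(A) <= 1/2, hence first tightness and then uniform integrability of the
   positive parts.  The negative parts follow from rho'; the bounds on E[X] come
   from E <= rho and E <= rho'. *)

(** * Events of prescribed probability *)

Section real_probability.
Context (d : measure_display) (T : measurableType d) (R : realType).
Variable P : probability T R.

Definition pr (A : set T) : R := fine (P A).

Lemma EFin_pr A : measurable A -> P A = (pr A)%:E.
Proof. by move=> mA; rewrite /pr fineK// fin_num_measure. Qed.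

Lemma pr_ge0 A : 0 <= pr A.
Proof. exact: fine_ge0. Qed.

Lemma pr_le1 A : measurable A -> pr A <= 1.
Proof. by move=> mA; rewrite -lee_fin -EFin_pr// probability_le1. Qed.

Lemma pr_le A B : measurable A -> measurable B -> A `<=` B -> pr A <= pr B.
Proof. by move=> mA mB AB; rewrite -lee_fin -!EFin_pr// le_measure// inE. Qed.

Lemma prU A B : measurable A -> measurable B -> A `&` B = set0 ->
  pr (A `|` B) = pr A + pr B.
Proof.
move=> mA mB AB; apply: EFin_inj.
by rewrite EFinD -!EFin_pr//; [exact: measureU|exact: measurableU].
Qed.

Lemma prD A B : measurable A -> measurable B -> B `<=` A ->
  pr (A `\` B) = pr A - pr B.
Proof.
move=> mA mB BA; rewrite -[in RHS](setDUK BA) prU ?addrK ?addKr//.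
- by rewrite addrC addKr.
- exact: measurableD.
- exact: setDIK.
Qed.

Lemma pr_set0 : pr set0 = 0.
Proof. by rewrite /pr measure0. Qed.

Lemma pr_setT : pr setT = 1.
Proof. by rewrite /pr probability_setT. Qed.

Hypothesis hP : atomless P.

(** Atomlessness splits [A] into two pieces of positive probability, and one of the two carries at
    most half of it. *)
Lemma atomless_half A : measurable A -> 0 < pr A -> exists B,
  [/\ measurable B, B `<=` A, 0 < pr B & pr B <= pr A / 2].
Proof.
move=> mA A0; have [|B [mB BA]] := hP mA.
  by rewrite EFin_pr// lte_fin.
rewrite !EFin_pr// !lte_fin => B0 ltBA.
have [le2|gt2] := leP (pr B) (pr A / 2); first by exists B.
exists (A `\` B); rewrite prD//; split => //; try lra; first exact: measurableD.
Qed.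

Lemma atomless_small A (e : R) : measurable A -> 0 < pr A -> 0 < e ->
  exists B, [/\ measurable B, B `<=` A, 0 < pr B & pr B <= e].
Proof.
move=> mA A0 e0.
have H (n : nat) : exists B,
    [/\ measurable B, B `<=` A, 0 < pr B & pr B * n%:R <= 1].
  elim: n => [|n [B [mB BA B0 Bn]]].
    by exists A; split => //; rewrite mulr0.
  have [C [mC CB C0 hC]] := atomless_half mB B0.
  exists C; split => //; first exact: subset_trans BA.
  (* At [n = 0] the induction hypothesis is void, so [pr C <= 1] is used instead. From then on
     halving suffices, because [(n + 2) / 2 <= n + 1]. *)
  case: n Bn => [|n] Bn; first by rewrite mulr1 pr_le1.
  apply: le_trans Bn; rewrite (le_trans (ler_wpM2r _ hC))// -mulrA ler_wpM2l//.
    exact: ltW.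
  rewrite ler_pdivrMl// -natrM ler_nat; lia.
have [n hn] : exists n : nat, e^-1 < n%:R.
  by exists (Num.truncn e^-1).+1; rewrite truncnS_gt.
have [B [mB BA B0 Bn]] := H n; exists B; split => //.
have n0 : 0 < n%:R :> R by apply: lt_trans hn; rewrite invr_gt0.
rewrite -(ler_pM2r n0) (le_trans Bn)// -(ler_pM2l (x := e^-1)) ?invr_gt0//.
by rewrite mulr1 mulKf ?gt_eqF// ltW.
Qed.

(* Each step of the greedy construction gains at least half of what is still
   available. *)
Lemma sierpinski A (q : R) : measurable A -> 0 <= q <= pr A ->
  exists B, [/\ measurable B, B `<=` A & pr B = q].
Proof.
move=> mA /andP[q0 qA].
pose good B := [/\ measurable B, B `<=` A & pr B <= q].
have step B : good B -> exists B', [/\ good B', B `<=` B' &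
    forall C, good C -> B `<=` C -> pr C - pr B <= 2 * (pr B' - pr B)].
  move=> gB; pose E := [set pr C - pr B | C in [set C | good C /\ B `<=` C]].
  have E0 : E 0 by exists B; [split|rewrite subrr].
  have hE : has_sup E.
    split; first by exists 0.
    exists q => _ [C [[_ _ Cq] _] <-]; have := pr_ge0 B; lra.
  (* If no good extension gains anything, [B] is its own successor; otherwise a gain above half the
     supremum is attained. *)
  have [s0|s0] := leP (sup E) 0.
    exists B; split => // C gC BC; rewrite subrr mulr0 (le_trans _ s0)//.
    by apply: sup_upper_bound => //; exists C.
  have [_ [B' [gB' BB'] <-] hB'] := sup_adherent (divr_gt0 s0 (ltr0n _ 2)) hE.
  exists B'; split => // C gC BC.
  have : pr C - pr B <= sup E by apply: sup_upper_bound => //; exists C.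
  lra.
have g0 : good set0 by split => //; rewrite pr_set0.
pose X := {B | good B}.
have /choice[f hf] : forall B : X, exists B' : X,
    sval B `<=` sval B' /\ forall C, good C -> sval B `<=` C ->
      pr C - pr (sval B) <= 2 * (pr (sval B') - pr (sval B)).
  move=> [B gB]; have [B' [gB' BB' h]] := step B gB.
  by exists (exist _ B' gB').
pose F n := sval (iter n f (exist _ set0 g0)).
have gF n : good (F n) by rewrite /F; case: (iter _ _ _).
have FS n : F n `<=` F n.+1 by rewrite /F iterS;
  case: (hf (iter n f (exist _ set0 g0))).
have hF n C : good C -> F n `<=` C ->
  pr C - pr (F n) <= 2 * (pr (F n.+1) - pr (F n)).
  by rewrite /F iterS; case: (hf (iter n f (exist _ set0 g0))) => _; exact.
have mF n : measurable (F n) by case: (gF n).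
pose B := \bigcup_n F n.
have mB : measurable B by exact: bigcup_measurable.
have BA : B `<=` A by move=> x [n _]; case: (gF n) => _ + _; apply.
have Bq : pr B <= q.
  have ndF : nondecreasing_seq F.
    by apply/nondecreasing_seqP => n; apply/subsetPset.
  have PF := nondecreasing_cvg_mu (mu := P) mF mB ndF.
  have : (fine \o (P \o F)) @ \oo --> pr B.
    by apply: fine_cvg; rewrite -EFin_pr.
  move=> /cvg_lim <-//; apply: limr_le.
    by apply/cvg_ex; exists (pr B); apply: fine_cvg; rewrite -EFin_pr.
  by near=> n; case: (gF n).
(* If [pr B < q], a small event [E] of positive probability outside [B] could still be added. Then
   [B] with [E] was available at every stage, so every stage gained at least [pr E / 2], and
   [pr (F n)] would exceed 1. *)
exists B; split => //; apply/eqP; rewrite eq_le Bq leNgt; apply/negP => ltBq.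
have [|||E [mE EA E0 Eq]] := @atomless_small (A `\` B) (q - pr B).
- exact: measurableD.
- by rewrite prD//; lra.
- lra.
have gC : good (B `|` E).
  split; first exact: measurableU.
    by move=> x [/BA//|/EA[]].
  rewrite prU//; first lra.
  by rewrite -subset0 => x [Bx /EA[_ /(_ Bx)]].
have stepE n : pr E / 2 <= pr (F n.+1) - pr (F n).
  have FB : F n `<=` B by move=> x Fx; exists n.
  have := hF _ _ gC (subset_trans FB (@subsetUl _ _ _)).
  have := pr_le (mF n) mB FB.
  rewrite prU//; first lra.
  by rewrite -subset0 => x [Bx /EA[_ /(_ Bx)]].
have nE (n : nat) : n%:R * (pr E / 2) <= pr (F n).
  elim: n => [|n IH]; first by rewrite mul0r pr_ge0.
  rewrite -natr1 mulrDl mul1r; have := stepE n; lra.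
pose n := (Num.truncn (pr E / 2)^-1).+1.
have : (pr E / 2)^-1 < n%:R by rewrite truncnS_gt.
have E2 : 0 < pr E / 2 by lra.
rewrite -(ltr_pM2r E2) mulVf ?gt_eqF// => /lt_le_trans/(_ (nE n)).
by rewrite ltNge pr_le1.
Unshelve. all: by end_near. Qed.

End real_probability.

(** * Means and integrable random variables *)

Section mean.
Context (d : measure_display) (T : measurableType d) (R : realType).
Variable P : probability T R.
Implicit Types (f g : T -> R) (X Y : L1 P).
Local Notation pr := (pr P).

Definition intg f : Prop := P.-integrable setT (EFin \o f).

Definition mean f : R := \int[P]_w f w.

Lemma intg_meas f : intg f -> measurable_fun setT f.
Proof. by move=> /integrableP[/measurable_EFinP]. Qed.

Lemma measurable_gt f (k : R) : measurable_fun setT f ->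
  measurable [set w | k < f w].
Proof.
move=> mf; rewrite (_ : mkset _ = setT `&` f @^-1` `]k, +oo[); first exact: mf.
by rewrite setTI; apply/seteqP; split => w /=; rewrite in_itv/= andbT.
Qed.

Lemma intgL1 X : intg X.
Proof. exact/Lfun1_integrable/LfunP. Qed.

Lemma intg_cst (c : R) : intg (fun=> c).
Proof. exact: finite_measure_integrable_cst. Qed.

Lemma intgD f g : intg f -> intg g -> intg (fun w => f w + g w).
Proof. by move=> hf hg; have := integrableD measurableT hf hg. Qed.

Lemma intgZ (k : R) f : intg f -> intg (fun w => k * f w).
Proof. by move=> hf; have := integrableZl measurableT k hf. Qed.

Lemma intgN f : intg f -> intg (fun w => - f w).
Proof. by move=> hf; have := integrableN hf. Qed.

Lemma intg_norm f : intg f -> intg (fun w => `|f w|).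
Proof. by move=> hf; have := integrable_norm hf. Qed.

Lemma intg_le f g : measurable_fun setT f -> (forall w, `|f w| <= `|g w|) ->
  intg g -> intg f.
Proof.
move=> mf fg; apply: le_integrable => //; first exact/measurable_EFinP.
by move=> w _; rewrite /= lee_fin.
Qed.

Lemma intg_indic A : measurable A -> intg \1_A.
Proof. by move=> mA; apply: integrable_indic. Qed.

Lemma intgM1 f A : measurable A -> intg f -> intg (fun w => f w * \1_A w).
Proof.
move=> mA hf; apply: (intg_le _ _ hf).
  by apply: measurable_funM; [exact: intg_meas|exact: measurable_indic].
move=> w; rewrite normrM ler_piMr// indicE.
by case: (_ \in _); rewrite /= ?normr0 ?normr1.
Qed.

Lemma intg_max0 f : intg f -> intg (fun w => Num.max (f w) 0).
Proof.
move=> hf; apply: (intg_le _ _ hf).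
  by apply: measurable_maxr => //; exact: intg_meas.
by move=> w; rewrite maxEle; case: ifP => // _; rewrite normr0.
Qed.

Lemma intg_sum (I : Type) (s : seq I) (f : I -> T -> R) :
  (forall i, intg (f i)) -> intg (fun w => \sum_(i <- s) f i w).
Proof.
move=> hf; elim: s => [|i s IH].
  rewrite (_ : (fun _ => _) = fun=> 0); first exact: intg_cst.
  by apply/funext => w; rewrite big_nil.
rewrite (_ : (fun _ => _) = fun w => f i w + \sum_(j <- s) f j w).
  exact: intgD.
by apply/funext => w; rewrite big_cons.
Qed.

Lemma meanD f g : intg f -> intg g ->
  mean (fun w => f w + g w) = mean f + mean g.
Proof. by move=> hf hg; rewrite /mean RintegralD. Qed.

Lemma meanB f g : intg f -> intg g ->
  mean (fun w => f w - g w) = mean f - mean g.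
Proof. by move=> hf hg; rewrite /mean RintegralB. Qed.

Lemma meanZ (k : R) f : intg f -> mean (fun w => k * f w) = k * mean f.
Proof. by move=> hf; rewrite /mean RintegralZl. Qed.

Lemma mean_cst (c : R) : mean (fun=> c) = c.
Proof. by rewrite /mean Rintegral_cst//= probability_setT mulr1. Qed.

Lemma meanN f : intg f -> mean (fun w => - f w) = - mean f.
Proof.
move=> hf; rewrite -mulN1r -meanZ//; congr mean.
by apply/funext => w; rewrite mulN1r.
Qed.

Lemma mean_indic A : measurable A -> mean \1_A = pr A.
Proof. by move=> mA; rewrite /mean /Rintegral integral_indic// setIT. Qed.

Lemma mean_indicZ A (c : R) : measurable A ->
  mean (fun w => c * \1_A w) = c * pr A.
Proof. by move=> mA; rewrite meanZ ?mean_indic//; exact: intg_indic. Qed.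

Lemma mean_sum (I : Type) (s : seq I) (f : I -> T -> R) :
  (forall i, intg (f i)) ->
  mean (fun w => \sum_(i <- s) f i w) = \sum_(i <- s) mean (f i).
Proof.
move=> hf; elim: s => [|i s IH].
  rewrite big_nil -[RHS](mean_cst 0); congr mean.
  by apply/funext => w; rewrite big_nil.
rewrite big_cons -IH -meanD//; last exact: intg_sum.
by congr mean; apply/funext => w; rewrite big_cons.
Qed.

Lemma mean_le f g : intg f -> intg g -> (forall w, f w <= g w) ->
  mean f <= mean g.
Proof. by move=> hf hg fg; apply: le_Rintegral. Qed.

Lemma mean_ae_le f g : intg f -> intg g -> {ae P, forall w, f w <= g w} ->
  mean f <= mean g.
Proof.
move=> hf hg fg.
(* The maximum of [f] and [g] dominates [f] everywhere and equals [g] almost surely, which reduces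
   the claim to a pointwise comparison. *)
have hm : intg (fun w => Num.max (f w) (g w)).
  apply: (@intg_le _ (fun w => `|f w| + `|g w|)); last first.
  - by apply: intgD; exact: intg_norm.
  - move=> w; rewrite [leRHS]ger0_norm ?addr_ge0// maxEle; case: ifP => _.
      by rewrite lerDr.
    by rewrite lerDl.
  - by apply: measurable_maxr; exact: intg_meas.
rewrite (_ : mean g = mean (fun w => Num.max (f w) (g w))).
  by apply: mean_le => // w; rewrite le_max lexx.
rewrite /mean /Rintegral; congr fine; apply: ae_eq_integral => //.
- exact/measurable_EFinP/intg_meas.
- exact/measurable_EFinP/(intg_meas hm).
- by apply: filterS fg => w fgw _; rewrite max_r.
Qed.

Lemma mean_ge0 f : (forall w, 0 <= f w) -> 0 <= mean f.
Proof. by move=> f0; apply: Rintegral_ge0. Qed.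

Lemma mean_norm f : intg f -> `|mean f| <= mean (fun w => `|f w|).
Proof. by move=> hf; apply: le_normr_Rintegral. Qed.

Lemma EFin_mean f : intg f -> (\int[P]_w (f w)%:E)%E = (mean f)%:E.
Proof. by move=> hf; rewrite /mean /Rintegral fineK//;
  exact: integrable_fin_num. Qed.

Lemma expectationE f : intg f -> 'E_P[f]%E = (mean f)%:E.
Proof. by move=> hf; rewrite unlock EFin_mean. Qed.

Lemma mean_abs_continuous f (e : R) : intg f -> 0 < e -> exists2 r : R, 0 < r &
  forall A, measurable A -> pr A < r -> mean (fun w => `|f w| * \1_A w) < e.
Proof.
move=> hf e0; have [r [r0 H]] := integral_normr_continuous hf e0.
exists r => // A mA Ar.
have : (\int[P]_(x in A) `|f x| < e)%R by apply: H => //; move: Ar;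
  rewrite -lte_fin -EFin_pr.
rewrite Rintegral_mkcond/=; apply: le_lt_trans.
rewrite le_eqVlt; apply/orP; left; apply/eqP; congr mean.
by apply/funext => w; rewrite patchE indicE; case: ifP; rewrite ?mulr1 ?mulr0.
Qed.

Definition L1_of f (hf : intg f) : L1 P :=
  Lfun_Sub (@lexx _ _ 1%E) (proj2 (Lfun1_integrable P f) hf).

Lemma L1_ofE f (hf : intg f) w : L1_of hf w = f w.
Proof. by []. Qed.

Lemma L1_addE X Y w : (X + Y)%R w = X w + Y w.
Proof. by []. Qed.

Lemma L1_scaleE (k : R) X w : (k *: X)%R w = k * X w.
Proof. by []. Qed.

Lemma L1_oppE X w : (- X)%R w = - X w.
Proof. by []. Qed.

Lemma L1_cstE (c : R) w : L1_cst P c w = c.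
Proof. by []. Qed.

Lemma L1_sumE (I : Type) (s : seq I) (F : I -> L1 P) w :
  (\sum_(i <- s) F i)%R w = \sum_(i <- s) F i w.
Proof. by elim: s => [|i s IH]; rewrite ?big_nil// !big_cons L1_addE IH. Qed.

(** Both means are integrals of [h] against the image laws, and such integrals only see the values
    of a law on Borel sets. *)
Lemma same_law_mean X Y (h : R -> R) : same_law X Y -> measurable_fun setT h ->
  intg (h \o X) -> intg (h \o Y) -> mean (h \o X) = mean (h \o Y).
Proof.
move=> XY mh hX hY; rewrite /mean /Rintegral; congr fine.
have mEh : measurable_fun setT (EFin \o h) by exact/measurable_EFinP.
have := @integral_distribution _ _ _ _ _ P X (EFin \o h) mEh hX.
have := @integral_distribution _ _ _ _ _ P Y (EFin \o h) mEh hY.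
move=> /= <- <-; apply: eq_measure_integral => A mA _; exact: XY.
Qed.

Lemma L1_dist X Y : 'N[P]_1[EFin \o (X - Y)%R]%E
  = (mean (fun w => `|X w - Y w|))%:E.
Proof.
rewrite Lnorm1 -EFin_mean//.
by apply: intg_norm; apply: intgD; [|apply: intgN]; exact: intgL1.
Qed.

(** The form in which lower semicontinuity is used: approximations within [1 / (n + 1)] form a
    sequence converging to [X] in L^1. *)
Lemma lsc_le (rho : L1 P -> \bar R) X (c : \bar R) : lsc rho ->
  (forall e : R, 0 < e -> exists2 Y : L1 P, mean (fun w => `|Y w - X w|) <= e &
     (rho Y <= c)%E) ->
  (rho X <= c)%E.
Proof.
move=> lscr H.
have /choice[Y hY] : forall n : nat, exists Y : L1 P,
    mean (fun w => `|Y w - X w|) <= n.+1%:R^-1 /\ (rho Y <= c)%E.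
  move=> n; have [|Y h1 h2] := H n.+1%:R^-1; first by rewrite invr_gt0.
  by exists Y.
have cvgY : L1_cvg Y X.
  rewrite /L1_cvg; under eq_cvg do rewrite L1_dist.
  apply: cvg_EFin; first exact: nearW.
  apply: (@squeeze_cvgr _ _ _ _ (cst 0) (fun n => n.+1%:R^-1)).
  - by apply: nearW => n; rewrite mean_ge0//=; case: (hY n).
  - exact: cvg_cst.
  - exact: cvg_harmonic.
apply: le_trans (lscr _ _ cvgY) _; rewrite limn_einf_lim.
apply: lime_le; first exact: is_cvg_einfs.
apply: nearW => n; apply: le_trans (_ : rho (Y n) <= c)%E; last by case: (hY n).
by apply: ereal_inf_lbound; exists n => /=.
Qed.

End mean.

(** * Equipartitions with small oscillation *)

Section equipartition.
Context (d : measure_display) (T : measurableType d) (R : realType).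
Variable P : probability T R.
Implicit Types (f g : T -> R) (X Y : L1 P).
Local Notation pr := (pr P).
Local Notation mean := (mean P).
Local Notation intg := (intg P).
Hypothesis hP : atomless P.

Lemma markov_norm f (k : R) : intg f -> 0 < k ->
  pr [set w | k < `|f w|] <= mean (fun w => `|f w|) / k.
Proof.
move=> hf k0.
have mA : measurable [set w | k < `|f w|].
  by apply: measurable_gt; exact: intg_meas (intg_norm hf).
rewrite ler_pdivlMr// mulrC -mean_indicZ//; apply: mean_le.
- by apply: intgZ; exact: intg_indic.
- exact: intg_norm.
- move=> w; rewrite indicE; case: (boolP (w \in _)) => [|_].
    by rewrite inE/= mulr1 => /ltW.
  by rewrite mulr0.
Qed.

(** Cut [[-k, k]] into [m] bands of width [e]. The event where [|f| > k] has probability below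
    [e / 2], so when more than [e] of [C] remains, some band keeps at least [e / (2 m)] of it, and
    this is trimmed to exactly that probability. The size [h] is chosen before [H], so successive
    extractions all have the same probability. *)
Lemma extract_piece f C (e : R) : intg f -> measurable C -> 0 < e ->
  exists2 h : R, 0 < h & forall H, measurable H -> e < pr (C `\` H) ->
    exists Dx : set T * R, [/\ measurable Dx.1, Dx.1 `<=` C `\` H, pr Dx.1 = h &
      forall w, Dx.1 w -> Dx.2 <= f w <= Dx.2 + e].
Proof.
move=> hf mC e0.
(* The added 1 makes Markov's bound strictly smaller than [e / 2] and keeps [k] positive. *)
pose k := 2 * (mean (fun w => `|f w|) + 1) / e.
have m0 : 0 <= mean (fun w => `|f w|) by exact: mean_ge0.
have k0 : 0 < k by rewrite divr_gt0// mulr_gt0// ltr_wpDl.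
pose tail := [set w | k < `|f w|].
have mtail : measurable tail.
  by apply: measurable_gt; exact: intg_meas (intg_norm hf).
have tail_lt : pr tail < e / 2.
  apply: le_lt_trans (markov_norm hf k0) _; rewrite ltr_pdivrMr// /k.
  rewrite [ltRHS](_ : _ = mean (fun w => `|f w|) + 1); first by rewrite ltrDl.
  by field; rewrite gt_eqF.
pose m := (Num.truncn (2 * k / e)).+1.
have hm : 2 * k / e < m%:R by rewrite truncnS_gt.
pose x (j : nat) : R := - k + j%:R * e.
pose E j := [set w | x j <= f w < x j + e].
have mf := intg_meas hf.
have mE j : measurable (E j).
  rewrite (_ : E j = setT `&` f @^-1` `[x j, x j + e[); first exact: mf.
  by rewrite setTI; apply/seteqP; split => w /=; rewrite in_itv.
have m_gt0 : 0 < m%:R :> R by rewrite ltr0n.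
exists (e / (2 * m%:R)); first by rewrite divr_gt0// mulr_gt0.
set h := e / _ => H mH eCH.
have mCH : measurable (C `\` H) by exact: measurableD.
have mI j : measurable (E j `&` (C `\` H)) by exact: measurableI.
(* Pigeonhole: otherwise the tail and the [m] bands together would cover less than
   [e / 2 + m * h = e]. *)
have [j hj] : exists j, h <= pr (E j `&` (C `\` H)).
  apply: contrapT => /forallNP hn.
  have : pr (C `\` H) <= pr tail + \sum_(j < m) pr (E j `&` (C `\` H)).
    rewrite -!mean_indic//.
    under eq_bigr do rewrite -mean_indic//.
    rewrite -mean_sum; last by move=> j; exact: intg_indic.
    rewrite -meanD; [|exact: intg_indic|by apply: intg_sum => j;
      exact: intg_indic].
    apply: mean_le; [exact: intg_indic| |].
      apply: intgD; first exact: intg_indic.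
      by apply: intg_sum => j; exact: intg_indic.
    move=> w; rewrite [leLHS]indicE; case: (boolP (w \in _)) => [wCH|_];
      last first.
      by rewrite addr_ge0//= sumr_ge0.
    have [wt|wt] := boolP (w \in tail).
      by rewrite indicE wt lerDl sumr_ge0.
    move: (wt); rewrite notin_setE /tail/= => /negP; rewrite -leNgt => fk.
    rewrite indicE (negbTE wt) add0r/=.
    have hj0 : 0 <= (f w + k) / e by rewrite divr_ge0 ?(ltW e0)//; move: fk;
      rewrite ler_norml; lra.
    have jm : (Num.truncn ((f w + k) / e) < m)%N.
      rewrite truncn_lt_nat// (le_lt_trans _ hm)// ler_pM2r ?invr_gt0//.
      by move: fk; rewrite ler_norml; lra.
    rewrite (bigD1 (Ordinal jm))//= indicE mem_set.
      by rewrite lerDl sumr_ge0.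
    split; last by rewrite -in_setE.
    have /andP[] := truncn_itv hj0; rewrite ler_pdivlMr// ltr_pdivrMr//.
    rewrite -natr1 /E /x/=; lra.
  apply/negP; rewrite -ltNge.
  apply: lt_trans eCH.
  have : \sum_(j < m) pr (E j `&` (C `\` H)) <= \sum_(j < m) h.
    by apply: ler_sum => j _; rewrite leNgt; apply/negP => /ltW; exact: hn.
  rewrite sumr_const card_ord -mulr_natr.
  have -> : h * m%:R = e / 2 by rewrite /h; field; rewrite gt_eqF.
  lra.
have [|D [mD DE prD]] := @sierpinski _ _ _ _ hP _ h (mI j).
  by rewrite hj andbT divr_ge0// ?ltW// mulr_gt0.
exists (D, x j); split => //=.
  by move=> w /DE[].
by move=> w /DE[/andP[-> /ltW ->]].
Qed.

Lemma indicU (A B : set T) w : A `&` B = set0 ->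
  \1_(A `|` B) w = \1_A w + \1_B w :> R.
Proof.
move=> AB; rewrite !indicE in_setU.
case: (boolP (w \in A)) => [|_]; last by rewrite add0r.
case: (boolP (w \in B)) => [|_ _]; last by rewrite addr0.
by rewrite !inE => Bw Aw; exfalso; rewrite -[False]/(set0 w) -AB.
Qed.

(** Pieces of the common probability [h] are extracted one after the other until at most [e] of [C]
    is left; since probabilities are at most 1, this stops. [H n] is the union of the first [n]
    pieces, and the first stopping index is taken, so that all earlier extractions are
    legitimate. *)
Lemma equipartition f C (e : R) : intg f -> measurable C -> 0 < e ->
  exists (n : nat) (D : 'I_n -> set T) (x : 'I_n -> R) (h : R) (G : set T),
  [/\ 0 < h,
      forall i, [/\ measurable (D i), pr (D i) = h &
        forall w, D i w -> x i <= f w <= x i + e],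
      forall i j w, D i w -> D j w -> i = j,
      forall w, \1_G w = \sum_(i < n) \1_(D i) w :> R &
      [/\ measurable G, G `<=` C & pr (C `\` G) <= e]].
Proof.
move=> hf mC e0; have [h h0 step] := extract_piece hf mC e0.
have /choice[S hS] : forall H, exists Dx : set T * R,
    measurable H -> e < pr (C `\` H) ->
    [/\ measurable Dx.1, Dx.1 `<=` C `\` H, pr Dx.1 = h &
      forall w, Dx.1 w -> Dx.2 <= f w <= Dx.2 + e].
  move=> H; case: (pselect (measurable H)) => mH; last by exists (set0, 0).
  case: (ltP e (pr (C `\` H))) => eH; last by exists (set0, 0).
  by have [Dx ?] := step H mH eH; exists Dx.
pose H := fix H n := if n is n'.+1 then H n' `|` (S (H n')).1 else set0.
pose stop n := pr (C `\` H n) <= e.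
have HP n : (forall i, (i < n)%N -> ~~ stop i) ->
    [/\ measurable (H n), H n `<=` C, pr (H n) = n%:R * h &
      forall w, \1_(H n) w = \sum_(i < n) \1_((S (H i)).1) w :> R].
  elim: n => [_|n IH hn].
    split; [exact: measurable0|by move=> w []|by rewrite /= pr_set0 mul0r|
      by move=> w; rewrite big_ord0 indic0].
  have [mHn HC prH indH] := IH (fun i hi => hn i (ltnW hi)).
  have := hn n (ltnSn n); rewrite /stop -ltNge => /(hS _ mHn)[mS SC prS _].
  have dis : H n `&` (S (H n)).1 = set0.
    by rewrite -subset0 => w [Hw /SC[_]].
  split => /=; first exact: measurableU.
  - by move=> w [/HC//|/SC[]].
  - by rewrite prU// prH prS -natr1 mulrDl mul1r.
  - by move=> w; rewrite big_ord_recr/= -indH indicU.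
have exn : exists n, stop n.
  apply: contrapT => /forallNP hn.
  pose n := (Num.truncn h^-1).+1.
  have [mH _ prH _] := HP n (fun i _ => introN idP (hn i)).
  have := pr_le1 P mH; rewrite prH leNgt => /negP; apply.
  by rewrite -ltr_pdivrMr// mul1r truncnS_gt.
case: (ex_minnP exn) => n stopn minn.
have notstop i : (i < n)%N -> ~~ stop i.
  by move=> lt_in; apply/negP => /minn; rewrite leqNgt lt_in.
have SP i : (i < n)%N -> [/\ measurable (S (H i)).1,
    (S (H i)).1 `<=` C `\` H i, pr (S (H i)).1 = h &
    forall w, (S (H i)).1 w -> (S (H i)).2 <= f w <= (S (H i)).2 + e].
  move=> lt_in; apply: hS; last by rewrite ltNge; exact: notstop.
  by have [] := HP i (fun j hj => notstop j (ltn_trans hj lt_in)).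
have [mH HC _ indH] := HP n notstop.
exists n, (fun i : 'I_n => (S (H i)).1), (fun i : 'I_n => (S (H i)).2), h,
  (H n).
split => //.
- by move=> i; have [] := SP i (ltn_ord i).
(* Piece [i] lies in every later [H], which later pieces avoid; this gives disjointness. *)
- have SH i k w : (S (H i)).1 w -> H (i + k.+1)%N w.
    move=> Sw; rewrite addnS; elim: k => [|k IH] /=; first by right;
      rewrite addn0.
    by left; rewrite addnS.
  have dis (i j : 'I_n) w : (i < j)%N -> (S (H i)).1 w -> ~ (S (H j)).1 w.
    move=> ltij Di Dj; have [_ /(_ _ Dj)[_ + _ _]] := SP j (ltn_ord j); apply.
    by have := SH i (j - i.+1)%N w Di; rewrite addnS -addSn subnKC.
  move=> i j w Di Dj; apply/val_inj/eqP; rewrite eqn_leq.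
  by apply/andP; split; rewrite leqNgt; apply/negP => /dis; [apply;
    first exact: Dj|apply; first exact: Di].
Qed.

End equipartition.

(** * Averaging rearrangements *)

Section coherent.
Context (d : measure_display) (T : measurableType d) (R : realType).
Variable P : probability T R.
Implicit Types (f g : T -> R) (X Y : L1 P) (rho : L1 P -> \bar R).
Local Notation pr := (pr P).
Local Notation mean := (mean P).
Local Notation intg := (intg P).

(** The sum is the midpoint of [2 X] and [2 Y]. *)
Lemma coherent_subadd rho X Y : coherent_risk_measure rho ->
  (rho (X + Y)%R <= rho X + rho Y)%E.
Proof.
move=> cr; have h2 : 0 < 2 :> R by [].
have -> : (X + Y = 2^-1 *: (2 *: X) + (1 - 2^-1) *: (2 *: Y))%R.
  rewrite !scalerA mulVf// scale1r.
  by rewrite (_ : (1 - 2^-1) * 2 = 1) ?scale1r//; field.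
apply: le_trans (rm_convex cr _ _ _) _; first by apply/andP; split; lra.
rewrite !(rm_homog cr)// !muleA -!EFinM mulVf// mul1e.
by rewrite (_ : (1 - 2^-1) * 2 = 1) ?mul1e//; field.
Qed.

Lemma coherent0 rho : coherent_risk_measure rho -> rho 0 = 0%E.
Proof.
move=> cr; have h2 : 0 < 2 :> R by [].
have := rm_homog cr 0 h2; rewrite scaler0.
have := rm_cst_fin cr 0; have -> : L1_cst P 0 = 0 by apply/LfuneqP.
by case: (rho 0) => // r _ /(congr1 fine) /= hr; congr (_%:E); lra.
Qed.

Lemma coherent_cst rho (c : R) : coherent_risk_measure rho ->
  rho (L1_cst P c) = c%:E.
Proof.
by move=> cr; rewrite -[L1_cst P c]add0r rm_cash// coherent0// add0e.
Qed.

Lemma coherent_le rho X Y : coherent_risk_measure rho ->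
  (forall w, X w <= Y w) -> (rho X <= rho Y)%E.
Proof. by move=> cr XY; apply: rm_mono => //; exact: aeW. Qed.

Lemma coherent_sum rho (I : Type) (s : seq I) (F : I -> L1 P) (c : I -> R) :
  coherent_risk_measure rho -> (forall i, rho (F i) <= (c i)%:E)%E ->
  (rho (\sum_(i <- s) F i)%R <= (\sum_(i <- s) c i)%:E)%E.
Proof.
move=> cr Fc; elim: s => [|i s IH]; first by rewrite !big_nil coherent0.
rewrite !big_cons EFinD; apply: le_trans (coherent_subadd _ _ cr) _.
exact: leeD.
Qed.

Lemma coherent_average rho n (F : 'I_n.+1 -> L1 P) (c : \bar R) :
  coherent_risk_measure rho -> (forall i, rho (F i) <= c)%E ->
  (rho (n.+1%:R^-1 *: \sum_i F i)%R <= c)%E.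
Proof.
(* The index type is nonempty, so [c = -oo] would contradict [rm_gtNy] at [F ord0]. *)
move=> cr; case: c => [c| |] Fc; first last.
- by have := Fc ord0; rewrite leeNy_eq => /eqP h;
  have := rm_gtNy cr (F ord0); rewrite h.
- exact: leey.
rewrite rm_homog ?invr_gt0//.
apply: le_trans (_ : n.+1%:R^-1%:E * (\sum_(i < n.+1) c)%:E <= _)%E.
  by rewrite lee_pmul2l ?lte_fin ?invr_gt0//; exact: coherent_sum.
by rewrite -EFinM lee_fin sumr_const card_ord -[c *+ _]mulr_natl mulKf.
Qed.

Section glue.
Variables (n : nat) (D : 'I_n -> set T).
Hypothesis mD : forall i, measurable (D i).
Hypothesis disD : forall i j w, D i w -> D j w -> i = j.

(** For disjoint cells, this is [f] overwritten by the constant [y i] on each [D i]. The additive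
    form yields integrability and means by linearity. *)
Definition glue f (y : 'I_n -> R) w := f w + \sum_i (y i - f w) * \1_(D i) w.

Lemma intg_glue f y : intg f -> intg (glue f y).
Proof.
move=> hf; apply: intgD => //; apply: intg_sum => i; apply: intgM1 => //.
by apply: intgD; [exact: intg_cst|exact: intgN].
Qed.

Lemma glue_in f y i w : D i w -> glue f y w = y i.
Proof.
move=> Di; rewrite /glue (bigD1 i)//= big1 => [|j ji].
  by rewrite indicE mem_set// mulr1 addr0 addrCA subrr addr0.
rewrite indicE memNset ?mulr0// => Dj.
by rewrite (disD Dj Di) eqxx in ji.
Qed.

Lemma glue_out f y w : (forall i, ~ D i w) -> glue f y w = f w.
Proof.
move=> nD; rewrite /glue big1 ?addr0// => i _.
by rewrite indicE memNset ?mulr0.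
Qed.

Lemma glue_comp f y (phi : R -> R) w :
  phi (glue f y w) = glue (phi \o f) (phi \o y) w.
Proof.
have [[i Di]|/forallNP nD] := pselect (exists i, D i w).
  by rewrite !(glue_in _ _ Di).
by rewrite !glue_out.
Qed.

(** With cells of equal probability the values [y] enter only through their sum, so permuting them
    does not change the mean. *)
Lemma mean_glue f y (h : R) : intg f -> (forall i, pr (D i) = h) ->
  mean (glue f y) = mean (fun w => f w + \sum_i (- f w) * \1_(D i) w)
                    + h * \sum_i y i.
Proof.
move=> hf hD; have hn i : intg (fun w => - f w * \1_(D i) w).
  by apply: intgM1 => //; exact: intgN.
have -> : h * \sum_i y i = mean (fun w => \sum_i y i * \1_(D i) w).
  rewrite mean_sum; last by move=> i; apply: intgZ; exact: intg_indic.
  by rewrite mulr_sumr; apply: eq_bigr => i _; rewrite mean_indicZ// hD mulrC.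
rewrite -meanD; last first.
  by apply: intg_sum => i; apply: intgZ; exact: intg_indic.
  by apply: intgD => //; exact: intg_sum.
congr mean; apply/funext => w; rewrite /glue -addrA -big_split/=; congr (_ + _).
by apply: eq_bigr => i _; rewrite -mulrDl addrC.
Qed.

End glue.

(** The condition on all [phi] expresses that [y] and [z] are rearrangements of each other. The
    indicator of [A] composed with a glued function is again glued, by [glue_comp], so [mean_glue]
    gives its mean and the condition is applied to the indicator of [A]. *)
Lemma glue_same_law n (D : 'I_n -> set T) f (y z : 'I_n -> R) (h : R)
    (hy : intg (glue D f y)) (hz : intg (glue D f z)) :
  (forall i, measurable (D i)) -> (forall i j w, D i w -> D j w -> i = j) ->
  (forall i, pr (D i) = h) -> measurable_fun setT f ->
  (forall phi : R -> R, \sum_i phi (y i) = \sum_i phi (z i)) ->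
  same_law (L1_of hy) (L1_of hz).
Proof.
move=> mD disD prD mf yz A mA.
have mpre g : measurable_fun setT g -> measurable (g @^-1` A).
  by move=> mg; rewrite -[X in measurable X]setTI; exact: mg.
have preE u (hu : intg (glue D f u)) : distribution P (L1_of hu) A =
    (mean (glue D (\1_A \o f) (\1_A \o u)))%:E.
  rewrite /distribution /pushforward -[X in P X]/(glue D f u @^-1` A).
  rewrite EFin_pr; last by apply: mpre; exact: intg_meas hu.
  congr (_%:E); rewrite -mean_indic; last by apply: mpre; exact: intg_meas hu.
  by congr mean; apply/funext => w; rewrite -(glue_comp disD).
have i1 : intg (\1_A \o f) by apply: (intg_indic P (mpre _ mf)).
by rewrite !preE !(mean_glue mD _ i1 prD) /comp yz.
Qed.

(** Addition in ['I_n.+1] is modulo [n + 1]: over the cyclic shifts [k], each cell receives every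
    value of [y] exactly once. *)
Lemma glue_average n (D : 'I_n.+1 -> set T) f (y : 'I_n.+1 -> R) w :
  n.+1%:R^-1 * (\sum_(k < n.+1) glue D f (fun i => y (i + k)) w) =
  glue D f (fun=> n.+1%:R^-1 * \sum_i y i) w.
Proof.
have n0 : n.+1%:R != 0 :> R by [].
rewrite /glue big_split/= sumr_const card_ord -[f w *+ _]mulr_natl mulrDr
  mulKf//.
congr (_ + _); rewrite exchange_big/= mulr_sumr; apply: eq_bigr => i _.
rewrite -mulr_suml sumrB sumr_const card_ord -[f w *+ _]mulr_natl mulrA
  mulrBr mulKf//.
congr ((_ * _ - _) * _).
by rewrite [RHS](reindex_inj (addrI i)).
Qed.

(** The averaged variable is the mean of the cyclic rearrangements of [y], which all have the same
    law and hence the same risk. *)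
Lemma rho_glue_average rho n (D : 'I_n.+1 -> set T) X (y : 'I_n.+1 -> R) (h : R)
    (hy : intg (glue D X y))
    (ha : intg (glue D X (fun=> n.+1%:R^-1 * \sum_i y i))) :
  coherent_risk_measure rho -> law_invariant rho ->
  (forall i, measurable (D i)) -> (forall i j w, D i w -> D j w -> i = j) ->
  (forall i, pr (D i) = h) ->
  (rho (L1_of ha) <= rho (L1_of hy))%E.
Proof.
move=> cr lr mD disD prD.
have hk (k : 'I_n.+1) : intg (glue D X (fun i => y (i + k))).
  by apply: intg_glue => //; exact: intgL1.
have -> : L1_of ha = n.+1%:R^-1 *: \sum_k L1_of (hk k).
  apply/LfuneqP => w; rewrite L1_scaleE L1_sumE L1_ofE -glue_average.
  by [].
apply: coherent_average => // k; rewrite le_eqVlt; apply/orP; left; apply/eqP.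
apply: lr; apply: glue_same_law mD disD prD _ _ => [|phi].
  exact: intg_meas (intgL1 X).
by rewrite [RHS](reindex_inj (addIr k)).
Qed.

Hypothesis hP : atomless P.

Lemma intg_dilate X C (a : R) : measurable C ->
  intg (fun w => X w + (a - X w) * \1_C w).
Proof.
move=> mC; apply: intgD; first exact: intgL1; apply: intgM1 => //.
by apply: intgD; [exact: intg_cst|apply: intgN; exact: intgL1].
Qed.

(** Lower [X] to [x i] on each cell of an equipartition of [C], then average these values to [b]:
    neither operation increases [rho]. The result is L^1-close to [X] with [a] on [C], and [lsc_le]
    concludes. *)
Lemma dilatation rho X C (mC : measurable C) (a : R) :
  coherent_risk_measure rho ->
  law_invariant rho -> lsc rho -> 0 < pr C ->
  a * pr C = mean (fun w => X w * \1_C w) ->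
  (rho (L1_of (intg_dilate X a mC)) <= rho X)%E.
Proof.
move=> cr lr lscr C0 aE; apply: lsc_le => // e e0.
have iX := intgL1 X.
have iXa : intg (fun w => X w - a) by apply: intgD => //; exact: intg_cst.
have [r r0 Hr] := mean_abs_continuous iXa (divr_gt0 e0 (ltr0n R 4)).
(* The three bounds serve, in order, to make the uncovered part of [C] contribute less than [e / 4],
   to bound the oscillation on the cells by [e / 4], and to guarantee at least one cell. *)
pose eps := Num.min (Num.min (r / 2) (e / 4)) (pr C / 2).
have eps0 : 0 < eps by rewrite !lt_min; apply/andP; split; [apply/andP;
  split|]; lra.
have epsr : eps < r.
  by rewrite /eps !gt_min; apply/orP; left; apply/orP; left; lra.
have epse : eps <= e / 4 by rewrite /eps !ge_min lexx orbT.
have epsC : eps < pr C by rewrite /eps !gt_min; apply/orP; right; lra.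
have [n [D [x [h [G [_ hD disD indG [mG GC prG]]]]]]] :=
  equipartition hP iX mC eps0.
have mD i : measurable (D i) by case: (hD i).
have prDh i : pr (D i) = h by case: (hD i).
have DX i w : D i w -> x i <= X w <= x i + eps by case: (hD i) => _ _; exact.
case: n => [|n] in D x hD disD indG mD prDh DX *.
  have G0 : G = set0.
    rewrite -subset0 => w Gw; have := indG w.
    by rewrite big_ord0 indicE mem_set// => /eqP; rewrite oner_eq0.
  by move: prG; rewrite G0 setD0 leNgt epsC.
pose b := n.+1%:R^-1 * \sum_i x i.
have hx := intg_glue mD x iX.
have hb := intg_glue mD (fun=> b) iX.
exists (L1_of hb); last first.
  apply: le_trans (rho_glue_average hx hb cr lr mD disD prDh) _.
  apply: coherent_le => // w; rewrite L1_ofE.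
  have [[i Di]|/forallNP nD] := pselect (exists i, D i w).
    by rewrite (glue_in disD _ _ Di); case/andP: (DX _ _ Di).
  by rewrite glue_out.
have mCG : measurable (C `\` G) by exact: measurableD.
have small : mean (fun w => `|X w - a| * \1_(C `\` G) w) < e / 4.
  by apply: Hr => //; exact: le_lt_trans prG _.
have indCG w : \1_C w = \1_G w + \1_(C `\` G) w :> R.
  by rewrite -indicU ?setDIK// setDUK.
have glueG w : glue D X (fun=> b) w = X w + (b - X w) * \1_G w.
  by rewrite /glue indG mulr_sumr.
have prGE : pr G = n.+1%:R * h.
  rewrite -mean_indic//;
    have -> : \1_G = (fun w => \sum_i \1_(D i) w) :> (T -> R).
    by apply/funext.
  rewrite mean_sum; last by move=> i; exact: intg_indic.
  under eq_bigr do rewrite mean_indic// prDh.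
  by rewrite sumr_const card_ord mulr_natl.
have iG : intg (fun w => (X w - a) * \1_G w) by exact: intgM1.
have iCG : intg (fun w => (X w - a) * \1_(C `\` G) w) by exact: intgM1.
(* By the choice of [a], [X - a] has integral zero over [C], so its integral over [G] is controlled
   by the one over the small rest. *)
have balance : mean (fun w => (X w - a) * \1_G w) +
    mean (fun w => (X w - a) * \1_(C `\` G) w) = 0.
  rewrite -meanD// (_ : (fun _ => _) = fun w => X w * \1_C w - a * \1_C w).
    rewrite meanB; [|exact: intgM1|by apply: intgZ; exact: intg_indic].
    by rewrite -aE mean_indicZ// subrr.
  by apply/funext => w; rewrite indCG; ring.
have bG : b * pr G = mean (fun w => \sum_i x i * \1_(D i) w).
  rewrite mean_sum; last by move=> i; apply: intgZ; exact: intg_indic.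
  under [RHS]eq_bigr do rewrite mean_indicZ// prDh.
  by rewrite -mulr_suml prGE /b; field.
have isum : intg (fun w => \sum_i (x i - X w) * \1_(D i) w).
  apply: intg_sum => i; apply: intgM1 => //.
  by apply: intgD; [exact: intg_cst|exact: intgN].
have bGa : (b - a) * pr G =
    mean (fun w => \sum_i (x i - X w) * \1_(D i) w)
      + mean (fun w => (X w - a) * \1_G w).
  rewrite mulrBl bG -[a * pr G]mean_indicZ// -meanB; last first.
  - by apply: intgZ; exact: intg_indic.
  - by apply: intg_sum => i; apply: intgZ; exact: intg_indic.
  rewrite -meanD//; congr mean; apply/funext => w.
  rewrite indG !mulr_sumr -sumrB -big_split/=; apply: eq_bigr => i _; ring.
have osc : `|mean (fun w => \sum_i (x i - X w) * \1_(D i) w)| <= eps.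
  apply: le_trans (mean_norm isum) _; rewrite -[leRHS](mean_cst P).
  apply: mean_le; [exact: intg_norm|exact: intg_cst|move=> w].
  have [[i Di]|/forallNP nD] := pselect (exists i, D i w).
    rewrite (bigD1 i)//= big1 => [|j ji].
      rewrite addr0 indicE mem_set// mulr1 distrC.
      by have /andP[h1 h2] := DX _ _ Di; rewrite ger0_norm ?subr_ge0// lerBlDl.
    by rewrite indicE memNset ?mulr0// => Dj;
      rewrite (disD _ _ _ Dj Di) eqxx in ji.
  by rewrite big1 ?normr0 ?ltW// => i _; rewrite indicE memNset ?mulr0.
have mean_abs_le : `|mean (fun w => (X w - a) * \1_(C `\` G) w)| <= e / 4.
  apply: le_trans (mean_norm iCG) _; apply: le_trans (ltW small).
  rewrite le_eqVlt; apply/orP; left; apply/eqP; congr mean; apply/funext => w.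
  by rewrite normrM [`|\1__ _|]ger0_norm.
(* One [e / 4] comes from the oscillation and one from [balance]; with the part outside [G], the L^1
   distance stays below [3 e / 4]. *)
have bGa_le : `|b - a| * pr G <= e / 2.
  rewrite -[pr G]ger0_norm ?pr_ge0// -normrM bGa.
  apply: le_trans (ler_normD _ _) _.
  have -> : mean (fun w => (X w - a) * \1_G w) =
      - mean (fun w => (X w - a) * \1_(C `\` G) w) by lra.
  rewrite normrN; lra.
apply: le_trans (_ : mean (fun w => `|b - a| * \1_G w
  + `|X w - a| * \1_(C `\` G) w) <= _).
  apply: mean_le.
  - by apply: intg_norm; apply: intgD => //; apply: intgN; exact: intg_dilate.
  - by apply: intgD; [apply: intgZ; exact: intg_indic|apply: intgM1 => //;
    exact: intg_norm].
  move=> w; rewrite !L1_ofE glueG indCG.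
  rewrite (_ : _ - _ = (b - a) * \1_G w + (X w - a) * \1_(C `\` G) w);
    last by ring.
  apply: le_trans (ler_normD _ _) _.
  by rewrite !normrM ![`|\1__ _|]ger0_norm.
rewrite meanD; [|by apply: intgZ; exact: intg_indic|by apply: intgM1 => //;
  exact: intg_norm].
rewrite mean_indicZ//; lra.
Qed.

End coherent.

(** * Lower bounds for infinite risk measures *)

Section necessity.
Context (d : measure_display) (T : measurableType d) (R : realType).
Variable P : probability T R.
Implicit Types (f g : T -> R) (X Y : L1 P) (rho : L1 P -> \bar R).
Local Notation pr := (pr P).
Local Notation mean := (mean P).
Local Notation intg := (intg P).
Hypothesis hP : atomless P.

Definition L1_indic A (mA : measurable A) : L1 P := L1_of (intg_indic P mA).

Lemma L1_indicE A (mA : measurable A) w : L1_indic mA w = \1_A w.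
Proof. by []. Qed.

Lemma L1_indic_same_law A B (mA : measurable A) (mB : measurable B) :
  pr A = pr B -> same_law (L1_indic mA) (L1_indic mB).
Proof.
move=> AB U mU.
have preE C (mC : measurable C) : distribution P (L1_indic mC) U =
    (\1_U 0 + (\1_U 1 - \1_U 0) * pr C)%:E.
  have mpre : measurable ((\1_C : T -> R) @^-1` U).
    by rewrite -[X in measurable X]setTI; exact: measurable_indic.
  rewrite /distribution /pushforward -[X in P X]/((\1_C : T -> R) @^-1` U).
  rewrite EFin_pr//; congr (_%:E); rewrite -mean_indic// -mean_indicZ//.
  rewrite -[X in _ = X + _](mean_cst P) -meanD; [|exact: intg_cst|].
    congr mean; apply/funext => w; rewrite [LHS]/(\1_U (\1_C w)) [\1_C w]indicE.
    rewrite [in RHS]indicE; case: (w \in C); last by rewrite mulr0 addr0.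
    by rewrite mulr1 addrC subrK.
  by apply: intgZ; exact: intg_indic.
by rewrite !preE AB.
Qed.

Lemma coherent_scale_indic rho A (mA : measurable A) (a : R) :
  coherent_risk_measure rho -> 0 <= a ->
  rho (a *: L1_indic mA)%R = (a%:E * rho (L1_indic mA))%E.
Proof.
move=> cr; rewrite le_eqVlt => /predU1P[<-|a0]; last exact: rm_homog.
by rewrite scale0r mul0e coherent0.
Qed.

(* If rho stayed linearly bounded on arbitrarily small events, dilatation would
   propagate the bound to all events, and then to L^1 by lower
   semicontinuity. *)
Lemma calR_concentrated rho (F : R) : calR rho -> exists2 p : R, 0 < p &
  forall A (mA : measurable A), 0 < pr A -> pr A <= p ->
    ((F * pr A)%:E <= rho (L1_indic mA))%E.
Proof.
move=> [cr lr lscr nfin]; apply: contrapT => Hn; apply: nfin.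
pose F' := Num.max F 0.
have F'0 : 0 <= F' by rewrite le_max lexx orbT.
have small (p : R) : 0 < p -> exists A (mA : measurable A),
    [/\ 0 < pr A, pr A <= p & (rho (L1_indic mA) <= (F' * pr A)%:E)%E].
  move=> p0; apply: contrapT => Hp; apply: Hn; exists p => // A mA A0 Ap.
  rewrite leNgt; apply/negP => ltA; apply: Hp; exists A, mA; split => //.
  apply: le_trans (ltW ltA) _; rewrite lee_fin ler_wpM2r ?pr_ge0//.
  by rewrite le_max lexx.
(* A small event [A] violating concentration is moved inside [B] as [A'] without changing the law of
   its indicator. Averaging that indicator over [B] gives [pr A / pr B] times the indicator of
   [B]. *)
have bound B (mB : measurable B) : 0 < pr B ->
    (rho (L1_indic mB) <= (F' * pr B)%:E)%E.
  move=> B0; have [A [mA [A0 AB hA]]] := small _ B0.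
  have [|A' [mA' A'B prA']] := @sierpinski _ _ _ _ hP _ (pr A) mB.
    by rewrite AB pr_ge0.
  have lawA : rho (L1_indic mA') = rho (L1_indic mA).
    by apply: lr; exact: L1_indic_same_law.
  pose a := pr A / pr B.
  have aE : a * pr B = mean (fun w => L1_indic mA' w * \1_B w).
    rewrite /a divfK ?gt_eqF// -prA' -mean_indic//; congr mean.
    apply/funext => w; rewrite L1_indicE !indicE.
    case: (boolP (w \in A')) => [|_]; last by rewrite mul0r.
    by rewrite inE => /A'B/mem_set ->; rewrite mulr1.
  have := dilatation hP mB cr lr lscr B0 aE.
  have -> : L1_of (intg_dilate (L1_indic mA') a mB) = a *: L1_indic mB.
    apply/LfuneqP => w; rewrite L1_ofE L1_scaleE.
    rewrite !L1_indicE !indicE.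
    case: (boolP (w \in A')) => [|_]; last by rewrite subr0 add0r.
    by rewrite inE => /A'B/mem_set ->; rewrite mulr1 mulr1 addrC subrK.
  rewrite coherent_scale_indic//; last by rewrite divr_ge0 ?pr_ge0.
  rewrite lawA => /le_trans/(_ hA).
  have a0 : 0 < a by rewrite divr_gt0.
  have -> : (F' * pr A)%:E = (a%:E * (F' * pr B)%:E)%E.
    by rewrite -EFinM mulrCA /a divfK ?gt_eqF.
  by rewrite lee_pmul2l.
move=> X; apply: (@le_lt_trans _ _ (F' * mean (fun w => `|X w|))%:E);
  last exact: ltry.
have iX := intg_norm (intgL1 X).
(* It remains to approximate [|X|] from below by step functions [Y], for which subadditivity and
   [bound] give [rho Y <= F' * E|X|]. *)
apply: le_trans (_ : rho X <= rho (L1_of iX))%E _.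
  by apply: coherent_le => // w; exact: ler_norm.
apply: lsc_le => // e e0.
have [r r0 Hr] := mean_abs_continuous iX (divr_gt0 e0 (ltr0n R 2)).
pose eps := Num.min (r / 2) (e / 2).
have eps0 : 0 < eps by rewrite lt_min; apply/andP; split; lra.
have epsr : eps < r by rewrite gt_min; apply/orP; left; lra.
have epse : eps <= e / 2 by rewrite ge_min lexx orbT.
have [n [D [x [h [G [h0 hD disD indG [mG _ prG]]]]]]] :=
  equipartition hP iX measurableT eps0.
have mD i : measurable (D i) by case: (hD i).
have prDh i : pr (D i) = h by case: (hD i).
have DX i w : D i w -> x i <= `|X w| <= x i + eps by case: (hD i) => _ _; exact.
(* The lower values [x i] may be negative although [|X|] is not; clipping keeps the coefficients
   nonnegative, as homogeneity requires. *)
pose y i := Num.max (x i) 0.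
pose Y := (\sum_i y i *: L1_indic (mD i))%R.
have YE w : Y w = \sum_i y i * \1_(D i) w by rewrite /Y L1_sumE.
have Yin i w : D i w -> Y w = y i.
  move=> Di; rewrite YE (bigD1 i)//= big1 => [|j ji].
    by rewrite addr0 indicE mem_set// mulr1.
  by rewrite indicE memNset ?mulr0// => Dj;
    rewrite (disD _ _ _ Dj Di) eqxx in ji.
have Yout w : (forall i, ~ D i w) -> Y w = 0.
  by move=> nD; rewrite YE big1// => i _; rewrite indicE memNset ?mulr0.
have yX i w : D i w -> y i <= `|X w| <= y i + eps.
  move=> /DX /andP[h1 h2]; rewrite ge_max h1 normr_ge0/= (le_trans h2)// lerD2r.
  by rewrite le_max lexx.
exists Y.
  apply: le_trans (_ : mean (fun w => eps
    + `| `|X w| | * \1_(setT `\` G) w) <= _).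
    apply: mean_le.
    - by apply: intg_norm; apply: intgD; [exact: intgL1|exact: intgN].
    - apply: intgD; [exact: intg_cst|apply: intgM1; last exact: intg_norm].
      exact: measurableD.
    move=> w; rewrite L1_ofE.
    have [[i Di]|/forallNP nD] := pselect (exists i, D i w).
      rewrite (Yin _ _ Di); have /andP[h1 h2] := yX _ _ Di.
      apply: le_trans (_ : eps <= _); last by rewrite lerDl mulr_ge0.
      by rewrite distrC ger0_norm ?subr_ge0// lerBlDl.
    rewrite Yout// sub0r normrN indicE mem_set;
      first by rewrite mulr1 lerDr ltW.
    split => // Gw; have := indG w; rewrite big1; last first.
      by move=> i _; rewrite indicE memNset.
    by rewrite indicE mem_set// => /eqP; rewrite oner_eq0.
  have mGc : measurable (setT `\` G) by exact: measurableD.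
  rewrite meanD; [|exact: intg_cst|by apply: intgM1 => //; exact: intg_norm].
  rewrite mean_cst; have := Hr _ mGc (le_lt_trans prG epsr); lra.
have yD0 i : (rho (y i *: L1_indic (mD i))%R <= (F' * (y i * pr (D i)))%:E)%E.
  rewrite coherent_scale_indic//; last by rewrite le_max lexx orbT.
  rewrite mulrCA EFinM; apply: lee_wpmul2l;
    first by rewrite lee_fin le_max lexx orbT.
  by apply: bound; rewrite prDh.
apply: le_trans (coherent_sum _ cr yD0) _.
rewrite lee_fin -mulr_sumr; apply: ler_wpM2l => //.
under eq_bigr do rewrite -mean_indicZ//.
rewrite -mean_sum; last by move=> i; apply: intgZ; exact: intg_indic.
apply: mean_le => //; first by apply: intg_sum => i; apply: intgZ;
  exact: intg_indic.
move=> w; rewrite -YE.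
have [[i Di]|/forallNP nD] := pselect (exists i, D i w).
  by rewrite (Yin _ _ Di); have /andP[] := yX _ _ Di.
by rewrite Yout.
Qed.

(** Averaging over the whole space turns [X] into the constant [mean X]. *)
Lemma coherent_ge_mean rho X : coherent_risk_measure rho ->
  law_invariant rho -> lsc rho -> ((mean X)%:E <= rho X)%E.
Proof.
move=> cr lr lscr; have prT : 0 < pr setT by rewrite pr_setT.
have aE : mean X * pr setT = mean (fun w => X w * \1_setT w).
  rewrite pr_setT mulr1; congr mean; apply/funext => w.
  by rewrite indicT mulr1.
apply: le_trans (dilatation hP measurableT cr lr lscr prT aE).
rewrite -(coherent_cst _ cr); apply: coherent_le => // w.
by rewrite L1_ofE indicT mulr1 addrC subrK.
Qed.

(** Averaging over [B] and then over its complement leaves a two-valued variable lying above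
    [a * \1_B - c], whose risk is at least [a * F * pr B - c = F * e - c]. *)
Lemma two_block_bound rho X B (mB : measurable B) (F M : R) :
  coherent_risk_measure rho -> law_invariant rho -> lsc rho ->
  0 < pr B -> pr B <= 2^-1 -> - M <= mean X ->
  0 <= M -> 0 <= mean (fun w => X w * \1_B w) ->
  ((F * pr B)%:E <= rho (L1_indic mB))%E ->
  (((F - 2) * mean (fun w => X w * \1_B w) - 2 * M)%:E <= rho X)%E.
Proof.
move=> cr lr lscr B0 B2 MX M0; set e := mean _ => e0 FB.
have mBc : measurable (~` B) by exact: measurableC.
have prBc : pr (~` B) = 1 - pr B by rewrite -setTD prD// pr_setT.
have Bc0 : 0 < pr (~` B) by rewrite prBc; lra.
pose a := e / pr B.
have aE : a * pr B = e by rewrite /a divfK ?gt_eqF.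
have a0 : 0 <= a by rewrite divr_ge0// ltW.
pose X1 := L1_of (intg_dilate X a mB).
pose b := (mean X - e) / pr (~` B).
have indC w : \1_(~` B) w = 1 - \1_B w :> R.
  by rewrite !indicE in_setC; case: (w \in B); rewrite /= ?subrr ?subr0.
have indid w : \1_B w * \1_B w = \1_B w :> R.
  by rewrite indicE; case: (w \in B); rewrite /= ?mulr1 ?mulr0.
have X1Bc w : X1 w * \1_(~` B) w = X w - X w * \1_B w.
  rewrite L1_ofE indC; have := indid w; move: (\1_B w) => t tt.
  by transitivity (X w - X w * t + (a - X w) * (t - t * t));
    [ring|rewrite tt; ring].
have bE : b * pr (~` B) = mean (fun w => X1 w * \1_(~` B) w).
  rewrite /b divfK ?gt_eqF// /e -meanB;
    [|exact: intgL1|by apply: intgM1 => //; exact: intgL1].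
  by congr mean; apply/funext => w; rewrite X1Bc.
apply: le_trans (dilatation hP mB cr lr lscr B0 aE).
apply: le_trans (dilatation hP mBc cr lr lscr Bc0 bE).
(* The mean of [X] on the complement is at least [- (M + e)] divided by a probability that is at
   least 1/2. *)
pose c := 2 * (M + e).
have bc : - c <= b.
  rewrite /b ler_pdivlMr// prBc /c.
  have : 0 <= (M + e) * (1 - 2 * pr B) by rewrite mulr_ge0; lra.
  lra.
apply: le_trans (_ : rho (a *: L1_indic mB + L1_cst P (- c))%R <= _)%E;
  last first.
  apply: coherent_le => // w; rewrite L1_ofE L1_addE L1_scaleE.
  rewrite L1_indicE -[L1_cst P (- c) w]/(- c) mulrBl X1Bc.
  rewrite L1_ofE indC indicE; case: (w \in B); rewrite /=;
    first by rewrite /c; lra.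
  lra.
rewrite rm_cash// coherent_scale_indic//.
apply: le_trans (_ : a%:E * (F * pr B)%:E + (- c)%:E <= _)%E; last first.
  by apply: leeD => //; exact: lee_wpmul2l.
by rewrite -EFinM -EFinD lee_fin mulrCA aE /c; lra.
Qed.

Lemma calR_tail rho (M M' eta : R) : calR rho -> 0 < eta ->
  exists K0 : R, forall K X, K0 <= K -> (rho X <= M%:E)%E -> - M' <= mean X ->
    mean (fun w => X w * \1_[set v | K < X v] w) <= eta.
Proof.
move=> rR eta0; have [cr lr lscr _] := rR.
wlog [M0 M'0] : M M' / 0 <= M /\ 0 <= M'.
  move=> /(_ (Num.max M 0) (Num.max M' 0))[|K0 HK0].
    by rewrite !le_max lexx !orbT.
  exists K0 => K X K0K XM XM'; apply: HK0 => //.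
    by apply: le_trans XM _; rewrite lee_fin le_max lexx.
  by apply: le_trans XM'; rewrite lerN2 le_max lexx.
pose L := M + 2 * M' + 1.
have L0 : 0 < L by rewrite /L; lra.
(* In [two_block_bound], the factor 3 leaves coefficient 1 on the tail mean, which yields tightness;
   the factor [2 + L / eta] leaves [L / eta], which brings the tail mean below [eta]. *)
have [p Hp0 Hp] := calR_concentrated 3 rR.
have [q Hq0 Hq] := calR_concentrated (2 + L / eta) rR.
pose p' := Num.min p 2^-1; pose q' := Num.min q 2^-1.
have p'0 : 0 < p' by rewrite lt_min Hp0 invr_gt0 ltr0n.
have q'0 : 0 < q' by rewrite lt_min Hq0 invr_gt0 ltr0n.
have p'p : p' <= p by rewrite ge_min lexx.
have p'2 : p' <= 2^-1 by rewrite ge_min lexx orbT.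
have q'q : q' <= q by rewrite ge_min lexx.
have q'2 : q' <= 2^-1 by rewrite ge_min lexx orbT.
(* Ensures [K > 0], [K > L / p'] (so that [tight] can exclude [pr A > p']) and [K >= L / q'] (so
   that tightness gives [pr A <= q']). *)
exists (L / p' + 1 + L / q') => K X K0K XM XM'.
have Lp0 : 0 < L / p' by exact: divr_gt0.
have Lq0 : 0 < L / q' by exact: divr_gt0.
have K0 : 0 < K by lra.
have iX := intgL1 X.
set A := [set v | K < X v].
have mA : measurable A by apply: measurable_gt; exact: intg_meas iX.
have ge_sub B : measurable B -> B `<=` A ->
  K * pr B <= mean (fun w => X w * \1_B w).
  move=> mB BA; rewrite -mean_indicZ//; apply: mean_le.
  - by apply: intgZ; exact: intg_indic.
  - exact: intgM1.
  move=> w; rewrite indicE; case: (boolP (w \in B)) => [|_];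
    last by rewrite !mulr0.
  by rewrite inE => /BA/ltW; rewrite !mulr1.
(* [A] may be too large for concentration, so the bound is first proved for a subevent [B] of
   probability [min p' (pr A)]. As [K > L / p'], it excludes [pr B = p'], hence [pr A = pr B]. *)
have tight : K * pr A <= L.
  have [|B [mB BA prB]] := @sierpinski _ _ _ _ hP A (Num.min p' (pr A)) mA.
    by rewrite le_min pr_ge0 (ltW p'0) ge_min lexx orbT.
  have Bp : pr B <= p' by rewrite prB ge_min lexx.
  have KB : K * pr B <= L.
    have := pr_ge0 P B; rewrite le_eqVlt => /predU1P[<-|B0].
      by rewrite mulr0 ltW.
    have eB := ge_sub _ mB BA.
    have e0 : 0 <= mean (fun w => X w * \1_B w).
      by apply: le_trans eB; rewrite mulr_ge0// ltW.
    have := two_block_bound cr lr lscr B0 (le_trans Bp p'2) XM' M'0 e0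
      (Hp _ mB B0 (le_trans Bp p'p)).
    move=> /le_trans/(_ XM); rewrite lee_fin /L; lra.
  suff AB : pr A = pr B by rewrite AB.
  apply/eqP; rewrite prB eq_sym; apply/eqP/min_r; rewrite leNgt;
    apply/negP => Ap.
  have : pr B = p' by rewrite prB; apply/min_l/ltW.
  move=> Bp'; move: KB; rewrite Bp' -ler_pdivlMr//; lra.
have Aq : pr A <= q'.
  have : L / q' <= K by lra.
  rewrite ler_pdivrMr// => /(le_trans tight).
  by rewrite ler_pM2l.
(* Concentration needs an event of positive probability; a null tail is covered by absolute
   continuity of the integral. *)
have := pr_ge0 P A; rewrite le_eqVlt => /predU1P[A0|A0].
  have [r r0 Hr] := mean_abs_continuous iX eta0.
  apply: le_trans (ltW (Hr A mA _)); last by rewrite -A0.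
  apply: mean_le; [exact: intgM1|by apply: intgM1 => //; exact: intg_norm|].
  by move=> w; rewrite ler_wpM2r// ler_norm.
have e0 : 0 <= mean (fun w => X w * \1_A w).
  by apply: le_trans (ge_sub A mA _) => //; rewrite mulr_ge0// ltW.
have := two_block_bound cr lr lscr A0 (le_trans Aq q'2) XM' M'0 e0
  (Hq _ mA A0 (le_trans Aq q'q)).
move=> /le_trans/(_ XM); rewrite lee_fin addrAC subrr add0r => H.
have : L / eta * mean (fun w => X w * \1_A w) <= L by rewrite {2}/L; lra.
by rewrite mulrAC ler_pdivrMr// ler_pM2l.
Qed.

End necessity.

(** * Optimized certainty equivalents *)

Section oce.
Context (d : measure_display) (T : measurableType d) (R : realType).
Variable P : probability T R.
Implicit Types (f g : T -> R) (X Y : L1 P) (rho : L1 P -> \bar R).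
Local Notation pr := (pr P).
Local Notation mean := (mean P).
Local Notation intg := (intg P).
Variables a c : R.
Hypotheses (a0 : 0 <= a) (a1 : a <= 1) (c1 : 1 <= c).

(** As a function of [x]: piecewise linear through [(t, t)], with slope [1 - a <= 1] below [t] and
    slope [1 - a + c >= 1] above, hence never below the identity. *)
Definition loss (t x : R) : R := t + (1 - a) * (x - t) + c * Num.max (x - t) 0.

Lemma maxr0_cases (x : R) :
  (0 <= x /\ Num.max x 0 = x) \/ (x <= 0 /\ Num.max x 0 = 0).
Proof.
by have [x0|x0] := leP 0 x; [left|right]; split => //; exact: ltW.
Qed.

Lemma loss_ge t x : x <= loss t x.
Proof.
have [ha0 ha1 hc1] := And3 a0 a1 c1.
rewrite /loss; have [[x0 ->]|[x0 ->]] := maxr0_cases (x - t).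
  have : 0 <= (c - a) * (x - t) by rewrite mulr_ge0//; lra.
  lra.
have : 0 <= a * (t - x) by rewrite mulr_ge0//; lra.
lra.
Qed.

Lemma loss_le t x y : x <= y -> loss t x <= loss t y.
Proof.
have [ha0 ha1 hc1] := And3 a0 a1 c1.
move=> xy; rewrite /loss lerD// ?lerD2l ?ler_wpM2l//; try lra.
by rewrite ge_max !le_max lerB// lexx orbT.
Qed.

(** Translation, scaling and subadditivity are stated jointly in [(t, x)]: this is what survives the
    infimum over [t] and makes [oce] coherent. *)
Lemma loss_shift t x s : loss (t + s) (x + s) = loss t x + s.
Proof. by rewrite /loss opprD addrACA subrr addr0; ring. Qed.

Lemma loss_scale l t x : 0 < l -> loss (l * t) (l * x) = l * loss t x.
Proof.
move=> l0; rewrite /loss -mulrBr -[X in Num.max _ X](mulr0 l) -maxr_pMr ?ltW//.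
by ring.
Qed.

Lemma loss_add t s x y : loss (t + s) (x + y) <= loss t x + loss s y.
Proof.
have [ha0 ha1 hc1] := And3 a0 a1 c1.
rewrite /loss; have c0 : 0 <= c by lra.
have : Num.max (x + y - (t + s)) 0 <= Num.max (x - t) 0 + Num.max (y - s) 0.
  have h1 : x - t <= Num.max (x - t) 0 by rewrite le_max lexx.
  have h2 : y - s <= Num.max (y - s) 0 by rewrite le_max lexx.
  have h3 : 0 <= Num.max (x - t) 0 by rewrite le_max lexx orbT.
  have h4 : 0 <= Num.max (y - s) 0 by rewrite le_max lexx orbT.
  rewrite ge_max; apply/andP; split; lra.
move=> /(ler_wpM2l c0); lra.
Qed.

(** Subadditivity at the thresholds [t] and [0] leaves [loss 0 (x - y)], whose largest slope is
    [1 - a + c]. *)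
Lemma loss_lip t x y : loss t x <= loss t y + (1 + c) * `|x - y|.
Proof.
have [ha0 ha1 hc1] := And3 a0 a1 c1.
have := loss_add t 0 y (x - y); rewrite addr0 addrC subrK => /le_trans; apply.
rewrite lerD2l; apply: le_trans (loss_le 0 (ler_norm _)) _.
rewrite /loss subr0 add0r max_l// [(1 + c) * _]mulrDl lerD2r ler_wpM2r//; lra.
Qed.

Lemma measurable_loss t : measurable_fun setT (loss t).
Proof.
apply: measurable_funD; first apply: measurable_funD => //.
  by apply: measurable_funM => //; exact: measurable_funB.
by apply: measurable_funM => //; apply: measurable_maxr => //;
  exact: measurable_funB.
Qed.

Lemma intg_loss t f : intg f -> intg (fun w => loss t (f w)).
Proof.
move=> hf; have hft : intg (fun w => f w - t).
  by apply: intgD => //; exact: intg_cst.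
apply: intgD; last by apply: intgZ; exact: intg_max0.
by apply: intgD; [exact: intg_cst|exact: intgZ].
Qed.

Definition oce_at X t : R := mean (fun w => loss t (X w)).

(* An optimized certainty equivalent (Ben-Tal-Teboulle): it is the mixture
   (1 - a) E + a ES in the Rockafellar-Uryasev form, with ES at level a / c. *)
Definition oce X : R := inf (range (oce_at X)).

Lemma oce_at_ge_mean X t : mean X <= oce_at X t.
Proof.
apply: mean_le => [||w]; [exact: intgL1|exact/intg_loss/intgL1|exact: loss_ge].
Qed.

Lemma oce_le X t : oce X <= oce_at X t.
Proof.
apply: inf_lbound; last by exists t.
by exists (mean X) => _ [s _ <-]; exact: oce_at_ge_mean.
Qed.

Lemma le_oce X b : (forall t, b <= oce_at X t) -> b <= oce X.
Proof.
move=> hb; apply: lb_le_inf; first by exists (oce_at X 0); exists 0.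
by move=> _ [t _ <-].
Qed.

Lemma oce_ge_mean X : mean X <= oce X.
Proof. by apply: le_oce => t; exact: oce_at_ge_mean. Qed.

Lemma oce_mono X Y : {ae P, forall w, X w <= Y w} -> oce X <= oce Y.
Proof.
move=> XY; apply: le_oce => t; apply: le_trans (oce_le X t) _.
apply: mean_ae_le; [exact/intg_loss/intgL1|exact/intg_loss/intgL1|].
by apply: filterS XY => w; exact: loss_le.
Qed.

Lemma oce_at_cash X (s t : R) :
  oce_at (X + L1_cst P s)%R (t + s) = oce_at X t + s.
Proof.
rewrite /oce_at -[X in _ = _ + X](mean_cst P) -meanD; last exact: intg_cst.
  by congr mean; apply/funext => w; rewrite -loss_shift.
exact/intg_loss/intgL1.
Qed.

Lemma oce_cash X (s : R) : oce (X + L1_cst P s)%R = oce X + s.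
Proof.
apply/eqP; rewrite eq_le; apply/andP; split.
  rewrite -lerBlDr; apply: le_oce => t.
  by rewrite lerBlDr -oce_at_cash oce_le.
by apply: le_oce => t; rewrite -[t](subrK s) oce_at_cash lerD2r oce_le.
Qed.

Lemma oce_scale_le X (l : R) : 0 < l -> oce (l *: X)%R <= l * oce X.
Proof.
move=> l0; rewrite -ler_pdivrMl//; apply: le_oce => t; rewrite ler_pdivrMl//.
apply: le_trans (oce_le _ (l * t)) _; rewrite /oce_at -meanZ;
  last exact/intg_loss/intgL1.
rewrite le_eqVlt; apply/orP; left; apply/eqP; congr mean.
by apply/funext => w; rewrite -loss_scale.
Qed.

Lemma oce_subadd X Y : oce (X + Y)%R <= oce X + oce Y.
Proof.
rewrite -lerBlDr; apply: le_oce => t; rewrite lerBlDr -lerBlDl;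
  apply: le_oce => s.
rewrite lerBlDl; apply: le_trans (oce_le _ (t + s)) _.
rewrite /oce_at -meanD; [|exact/intg_loss/intgL1|exact/intg_loss/intgL1].
apply: mean_le; [exact/intg_loss/intgL1| |move=> w; exact: loss_add].
by apply: intgD; exact/intg_loss/intgL1.
Qed.

Lemma oce_law X Y : same_law X Y -> oce X = oce Y.
Proof.
move=> XY; rewrite /oce; suff -> : oce_at X = oce_at Y by []; apply/funext => t.
by apply: (same_law_mean (h := loss t) XY);
  [exact: measurable_loss|exact: (intg_loss t (intgL1 X))|
   exact: (intg_loss t (intgL1 Y))].
Qed.

Lemma oce_lip X Y : oce X <= oce Y + (1 + c) * mean (fun w => `|X w - Y w|).
Proof.
rewrite -lerBlDr; apply: le_oce => t; rewrite lerBlDr.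
have hXY : intg (fun w => `|X w - Y w|).
  by apply: intg_norm; apply: intgD; [|apply: intgN]; exact: intgL1.
apply: le_trans (oce_le X t) _; rewrite /oce_at -meanZ// -meanD;
  last exact: intgZ.
  apply: mean_le => [||w]; [exact/intg_loss/intgL1| |exact: loss_lip].
  by apply: intgD; [exact/intg_loss/intgL1|exact: intgZ].
exact/intg_loss/intgL1.
Qed.

(** For [t >= 0], the positive part of [X - t] is at least [(X - t) * \1_A], and the term [a * t]
    pays for the loss [c * t * pr A]. For [t < 0], [X - t] is positive everywhere and the loss
    already exceeds [c * X]. *)
Lemma oce_ge_tail X A : measurable A -> (forall w, 0 <= X w) -> c * pr A <= a ->
  c * mean (fun w => X w * \1_A w) <= oce X.
Proof.
have [ha0 ha1 hc1] := And3 a0 a1 c1.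
move=> mA X0 cA; have c0 : 0 <= c by lra.
have iXA : intg (fun w => X w * \1_A w) by apply: intgM1 => //; exact: intgL1.
apply: le_oce => t; have [t0|t0] := leP 0 t.
  apply: le_trans (_ : mean (fun w => c * (X w * \1_A w)
    + (a * t - (c * t) * \1_A w)) <= _).
    rewrite meanD; [|exact: intgZ|]; last first.
      by apply: intgD; [exact: intg_cst|apply: intgN; apply: intgZ;
        exact: intg_indic].
    rewrite meanB; [|exact: intg_cst|by apply: intgZ; exact: intg_indic].
    rewrite meanZ// mean_cst mean_indicZ// lerDl.
    have : 0 <= (a - c * pr A) * t by rewrite mulr_ge0// subr_ge0.
    lra.
  apply: mean_le => [||w]; [|exact/intg_loss/intgL1|].
    apply: intgD; first exact: intgZ.
    by apply: intgD; [exact: intg_cst|apply: intgN; apply: intgZ;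
      exact: intg_indic].
  have h0 : 0 <= c * Num.max (X w - t) 0 by rewrite mulr_ge0// le_max lexx orbT.
  have h1 : c * (X w - t) <= c * Num.max (X w - t) 0.
    by rewrite ler_wpM2l// le_max lexx.
  have h2 : 0 <= (1 - a) * X w by rewrite mulr_ge0// subr_ge0.
  by rewrite /loss indicE; case: (w \in A); rewrite /=; lra.
rewrite -meanZ//; apply: mean_le => [||w];
  [exact: intgZ|exact/intg_loss/intgL1|].
apply: le_trans (_ : c * X w <= _).
  rewrite ler_wpM2l//; by rewrite ler_piMr.
have tX : 0 <= X w - t by have := X0 w; lra.
rewrite /loss max_l//.
have h2 : 0 <= (1 - a) * X w by rewrite mulr_ge0// subr_ge0.
have h3 : 0 <= (c - a) * (- t) by rewrite mulr_ge0//; lra.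
lra.
Qed.

Lemma oce_le_excess X t :
  oce X <= a * t + (1 - a) * mean X + c * mean (fun w => Num.max (X w - t) 0).
Proof.
have iX := intgL1 X.
have iXt : intg (fun w => Num.max (X w - t) 0).
  by apply: intg_max0; apply: intgD => //; exact: intg_cst.
apply: le_trans (oce_le X t) _; rewrite -!meanZ// -[a * t](mean_cst P).
rewrite -!meanD; [| | |exact: intg_cst|exact: intgZ]; last 2 first.
- by apply: intgD; [exact: intg_cst|exact: intgZ].
- exact: intgZ.
rewrite le_eqVlt; apply/orP; left; apply/eqP; congr mean; apply/funext => w.
by rewrite /loss; ring.
Qed.

End oce.

(** * Suprema of optimized certainty equivalents *)

Section sup_oce.
Context (d : measure_display) (T : measurableType d) (R : realType).
Variable P : probability T R.
Implicit Types (f g : T -> R) (X Y : L1 P) (rho : L1 P -> \bar R).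
Local Notation pr := (pr P).
Local Notation mean := (mean P).
Local Notation intg := (intg P).
Variables a c : nat -> R.
Hypotheses (a0 : forall n, 0 <= a n) (a1 : forall n, a n <= 1).
Hypothesis c1 : forall n, 1 <= c n.

Definition sup_oce X : \bar R :=
  ereal_sup (range (fun n => (oce (a n) (c n) X)%:E)).

Lemma sup_oce_ge X n : ((oce (a n) (c n) X)%:E <= sup_oce X)%E.
Proof. by apply: ereal_sup_ubound; exists n. Qed.

Lemma sup_oce_le X (b : \bar R) :
  (forall n, (oce (a n) (c n) X)%:E <= b)%E -> (sup_oce X <= b)%E.
Proof. by move=> h; apply: ge_ereal_sup => _ [n _ <-]. Qed.

Lemma sup_oce_ge_mean X : ((mean X)%:E <= sup_oce X)%E.
Proof. by apply: le_trans (sup_oce_ge X 0); rewrite lee_fin oce_ge_mean. Qed.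

Lemma sup_oce_cash_le X (s : R) :
  (sup_oce (X + L1_cst P s)%R <= sup_oce X + s%:E)%E.
Proof.
apply: sup_oce_le => n; rewrite oce_cash// EFinD leeD2r//; exact: sup_oce_ge.
Qed.

Lemma sup_oce_scale_le X (l : R) : 0 < l ->
  (sup_oce (l *: X)%R <= l%:E * sup_oce X)%E.
Proof.
move=> l0; apply: sup_oce_le => n.
apply: le_trans (_ : (l * oce (a n) (c n) X)%:E <= _)%E.
  by rewrite lee_fin oce_scale_le.
rewrite EFinM; apply: lee_wpmul2l; [by rewrite lee_fin ltW|exact: sup_oce_ge].
Qed.

Lemma sup_oce_coherent : coherent_risk_measure sup_oce.
Proof.
split.
- by move=> X; apply: lt_le_trans (sup_oce_ge_mean X); exact: ltNyr.
- move=> s; have sE n : oce (a n) (c n) (L1_cst P s) = s.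
    apply/eqP; rewrite eq_le; apply/andP; split.
      apply: le_trans (oce_le _ _ _ _ s) _ => //.
      rewrite -[leRHS](mean_cst P) le_eqVlt; apply/orP; left; apply/eqP.
      congr mean; apply/funext => w.
      by rewrite /loss L1_cstE subrr maxxx !mulr0 !addr0.
    by apply: le_trans (oce_ge_mean _ _ _ _) => //;
      rewrite -[leLHS](mean_cst P).
  have -> : sup_oce (L1_cst P s) = s%:E; last by [].
  apply/eqP; rewrite eq_le; apply/andP; split.
    by apply: sup_oce_le => n; rewrite sE.
  by rewrite -[X in (X%:E <= _)%E](sE 0); exact: sup_oce_ge.
- move=> X Y XY; apply: sup_oce_le => n; apply: le_trans (sup_oce_ge Y n).
  by rewrite lee_fin oce_mono.
- move=> X s; apply/eqP; rewrite eq_le sup_oce_cash_le/=.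
  (* The reverse inequality is the one-sided bound for the opposite shift; homogeneity below uses
     the inverse factor likewise. *)
  rewrite -leeBrDr//; have := sup_oce_cash_le (X + L1_cst P s)%R (- s).
  congr (_ <= _)%E; congr sup_oce; apply/LfuneqP => w.
  by rewrite !L1_addE !L1_cstE addrK.
- move=> X Y l /andP[l0 l1]; apply: sup_oce_le => n.
  apply: le_trans (_ : (l * oce (a n) (c n) X
    + (1 - l) * oce (a n) (c n) Y)%:E <= _)%E.
    rewrite lee_fin; apply: le_trans (oce_subadd _ _ _ _ _) _ => //.
    by apply: lerD; apply: oce_scale_le => //; rewrite subr_gt0.
  rewrite EFinD !EFinM; apply: leeD; apply: lee_wpmul2l;
    try exact: sup_oce_ge; rewrite lee_fin; lra.
- move=> X l l0; apply/eqP; rewrite eq_le sup_oce_scale_le//=.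
  have linv : 0 < l^-1 by rewrite invr_gt0.
  have := sup_oce_scale_le (l *: X) linv.
  rewrite scalerA mulVf ?gt_eqF// scale1r => H.
  have /(lee_wpmul2l (ltW (_ : 0 < l%:E)%E)) := H; rewrite lte_fin => /(_ l0).
  by rewrite muleA -EFinM divff ?gt_eqF// mul1e.
Qed.

Lemma sup_oce_law : law_invariant sup_oce.
Proof.
by move=> X Y XY; rewrite /sup_oce; under eq_fun do rewrite (oce_law _ _ XY).
Qed.

(** Each term is Lipschitz for the L^1 distance with constant [1 + c n], and a supremum of
    continuous functionals is lower semicontinuous. *)
Lemma sup_oce_lsc : lsc sup_oce.
Proof.
move=> Xn X cvX; rewrite limn_einf_lim; apply: sup_oce_le => n.
have {}cvX : mean (fun w => `|Xn k w - X w|) @[k --> \oo] --> 0.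
  move: cvX; rewrite /L1_cvg; under eq_cvg do rewrite L1_dist.
  by move=> /fine_cvgP[].
apply/lee_addgt0Pr => e e0.
have cn0 : 0 < 1 + c n by have := c1 n; lra.
have [N _ HN] : \forall k \near \oo, mean (fun w => `|Xn k w - X w|)
    <= e / (1 + c n).
  move/cvgr0Pnorm_le : cvX => /(_ (e / (1 + c n)))[|N _ HN];
    first exact: divr_gt0.
  exists N => // k Nk; exact: le_trans (ler_norm _) (HN k Nk).
rewrite -leeBlDr//.
apply: lime_ge; first exact: is_cvg_einfs.
exists N => // k Nk /=; apply: le_ereal_inf_tmp => _ [m /= km <-].
apply: le_trans (sup_oce_ge (Xn m) n).
rewrite -EFinB lee_fin lerBlDr.
apply: le_trans (oce_lip (a0 n) (a1 n) (c1 n) X (Xn m)) _; rewrite lerD2l.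
rewrite mulrC -ler_pdivlMr//; have := HN m (leq_trans Nk km).
by congr (_ <= _); congr mean; apply/funext => w; rewrite distrC.
Qed.

Hypothesis hP : atomless P.
Hypothesis a_gt0 : forall n, 0 < a n.
Hypothesis c4 : forall n, 4 ^+ n <= c n.

(* The witness is sum_n 2^-(n+1) 1_(A n) / P(A n), for events A n that the n-th
   term of the supremum weighs by c n. *)
Lemma sup_oce_not_finite : ~ finite_on_L1 sup_oce.
Proof.
have c0 n : 0 < c n by apply: lt_le_trans (c1 n).
have /choice[A hA] : forall n, exists A,
    [/\ measurable A, 0 < pr A & c n * pr A <= a n].
  move=> n; have [|||A [mA _ A0 Aa]] :=
    @atomless_small _ _ _ _ hP setT (a n / c n).
  - exact: measurableT.
  - by rewrite pr_setT.
  - exact: divr_gt0.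
  by exists A; split => //; rewrite mulrC -ler_pdivlMr.
have mA n : measurable (A n) by case: (hA n).
pose s n : R := 1 / (2 ^ n.+1)%:R.
have s0 n : 0 <= s n by rewrite divr_ge0.
pose f n w : R := s n / pr (A n) * \1_(A n) w.
have f0 n w : 0 <= f n w by rewrite mulr_ge0// divr_ge0// pr_ge0.
have fi n : intg (f n) by apply: intgZ; exact: intg_indic.
have mf n : mean (f n) = s n.
  by rewrite mean_indicZ// divfK// gt_eqF//; case: (hA n).
pose F w : \bar R := (\sum_(0 <= n <oo) (f n w)%:E)%E.
have mFn n : measurable_fun setT (fun w => (f n w)%:E).
  by apply/measurable_EFinP/(intg_meas (fi n)).
have mF : measurable_fun setT F.
  by apply: ge0_emeasurable_sum => // n w _ _; rewrite lee_fin.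
have F0 w : (0 <= F w)%E by apply: nneseries_ge0 => n _ _; rewrite lee_fin.
have iF : P.-integrable setT F.
  apply/integrableP; split => //.
  under eq_integral do rewrite gee0_abs//.
  rewrite /F integral_nneseries//; last by move=> n w _; rewrite lee_fin.
  under eq_eseriesr do rewrite EFin_mean// mf.
  by apply: le_lt_trans (epsilon_trick0 xpredT (@ler01 R)) _; exact: ltry.
(* The series may be infinite on a null set; [fine] gives 0 at such points, which is why [big]
   compares only almost surely. *)
have iX : intg (fine \o F).
  apply: (@le_integrable _ _ _ P setT measurableT _ F) => //.
    by apply/measurable_EFinP; apply: measurableT_comp.
  move=> w _ /=; rewrite ger0_norm ?fine_ge0// gee0_abs//.
  by case: (F w) (F0 w) => //= *; rewrite leey.
pose X := L1_of iX.
have X0 w : 0 <= X w by rewrite L1_ofE fine_ge0.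
have big n : s n <= mean (fun w => X w * \1_(A n) w).
  rewrite -mf; apply: mean_ae_le => //; first by apply: intgM1 => //;
    exact: intgL1.
  have := integrable_ae measurableT iF.
  apply: filterS => w /(_ I) Ffin.
  rewrite /f L1_ofE -[leLHS]/(f n w); have -> : f n w = f n w * \1_(A n) w.
    by rewrite /f indicE; case: (w \in A n); rewrite /= ?mulr1 ?mulr0.
  rewrite ler_wpM2r// -lee_fin /= fineK//.
  have := @nneseries_lim_ge R (fun n => (f n w)%:E) xpredT 0%N n.+1
    (fun i _ _ => f0 i w).
  rewrite big_mkcond/= big_nat_recr//=; apply: le_trans.
  by rewrite leeDr// sume_ge0// => i _; rewrite lee_fin.
move=> /(_ X); apply/negP; rewrite -leNgt leye_eq; apply/eqP/eq_infty => r.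
(* The n-th term is at least [4 ^ n * s n = 2 ^ n / 2], and [n < 2 ^ n]. *)
have [n hn] : exists n : nat, 2 * r < n%:R.
  by exists (Num.truncn `|2 * r|).+1; apply: le_lt_trans (ler_norm _) _;
    rewrite truncnS_gt.
apply: le_trans (sup_oce_ge X n); rewrite lee_fin.
have [_ _ cA] := hA n.
apply: le_trans (oce_ge_tail (a0 n) (a1 n) (c1 n) (mA n) X0 cA).
apply: le_trans (_ : 4 ^+ n * s n <= _); last first.
  by apply: ler_pM => //; rewrite exprn_ge0.
rewrite /s div1r natrX exprS (_ : 4 = 2 * 2 :> R); last by rewrite -natrM.
rewrite exprMn invfM mulrCA mulfK ?expf_neq0//.
rewrite -ler_pdivrMl ?invr_gt0// invrK; apply: le_trans (ltW hn) _.
by rewrite -natrX ler_nat; apply/ltnW/ltn_expl.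
Qed.

Lemma sup_oce_calR : calR sup_oce.
Proof.
split; [exact: sup_oce_coherent|exact: sup_oce_law|exact: sup_oce_lsc|].
exact: sup_oce_not_finite.
Qed.

End sup_oce.

(** * Uniform integrability *)

Section uniform_integrability.
Context (d : measure_display) (T : measurableType d) (R : realType).
Variable P : probability T R.
Implicit Types (X Y : L1 P) (S : set (L1 P)).
Local Notation mean := (mean P).
Local Notation intg := (intg P).

Definition tail_mean X (K : R) : R :=
  mean (fun w => `|X w| * \1_[set v | K < `|X v|] w).

Lemma indic_gt (f : T -> R) (K : R) w :
  \1_[set v | K < f v] w = (K < f w)%R%:R :> R.
Proof. by rewrite indicE; congr ((nat_of_bool _)%:R); apply/idP/idP;
  rewrite inE. Qed.

Lemma intg_tail X (K : R) : intg (fun w => `|X w| * \1_[set v | K < `|X v|] w).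
Proof.
have iX := intg_norm (intgL1 X).
by apply: intgM1 => //; apply: measurable_gt; exact: intg_meas iX.
Qed.

(** Removes the extended-real supremum. The 0 adjoined to the set keeps [u] nonnegative even when
    [S] is empty. *)
Lemma uniformly_integrableP S : uniformly_integrable S <->
  forall e : R, 0 < e -> exists K0 : R, forall K X, K0 <= K -> S X ->
    tail_mean X K <= e.
Proof.
rewrite /uniformly_integrable; set u := (u in u @ _ --> _).
have uE K X : S X -> ((tail_mean X K)%:E <= u K)%E.
  move=> SX; apply: ereal_sup_ubound; right; exists X => //.
  by rewrite expectationE//; exact: intg_tail.
have u0 K : (0 <= u K)%E by apply: ereal_sup_ubound; left.
split=> [cvu e e0|H].
  have [K0 [_ HK0]] : \forall K \near +oo%R, (u K < e%:E)%E.
    apply: (cvu [set x | x < e%:E]%E); apply: open_nbhs_nbhs.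
    by split; [exact: open_ereal_lt_ereal|rewrite /= lte_fin].
  exists (K0 + 1) => K X KK SX; rewrite -lee_fin (le_trans (uE K X SX))// ltW//.
  by apply: HK0; rewrite (lt_le_trans _ KK)// ltrDl.
have H' e : 0 < e -> \forall K \near +oo%R, (u K <= e%:E)%E.
  move=> e0; have [K0 HK0] := H e e0.
  exists K0; split; first exact: num_real.
  move=> K KK; apply: ge_ereal_sup => _ [->|[X SX <-]];
    first by rewrite lee_fin ltW.
  by rewrite expectationE ?lee_fin; [exact: HK0 (ltW KK) SX|exact: intg_tail].
have ufin e K : (u K <= e%:E)%E -> u K \is a fin_num.
  by move=> ue; rewrite ge0_fin_numE// (le_lt_trans ue)// ltry.
apply/fine_cvgP; split.
  by apply: filterS (H' 1 ltr01) => K; exact: ufin.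
apply/cvgr0Pnorm_le => e e0; apply: filterS (H' e e0) => K ue /=.
by rewrite ger0_norm ?fine_ge0// -lee_fin fineK//; exact: ufin ue.
Qed.

Lemma mean_norm_le_tail X (K e : R) : 0 <= K -> tail_mean X K <= e ->
  mean (fun w => `|X w|) <= K + e.
Proof.
move=> K0 Xe; apply: le_trans (_ : mean (fun w => K
  + `|X w| * \1_[set v | K < `|X v|] w) <= _).
  apply: mean_le => [||w]; [exact/intg_norm/intgL1| |].
    by apply: intgD; [exact: intg_cst|exact: intg_tail].
  rewrite indicE; case: (boolP (w \in _)) => [_|]; first by rewrite mulr1 lerDr.
  by rewrite notin_setE /= mulr0 addr0 => /negP; rewrite -leNgt.
by rewrite meanD ?mean_cst ?lerD2l//; [exact: intg_cst|exact: intg_tail].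
Qed.

Lemma ui_risk_bounded S : atomless P -> uniformly_integrable S ->
  exists2 rho, calR rho & bounded_over S (fun X => rho (L1_abs X)).
Proof.
move=> hP /uniformly_integrableP ui.
have /choice[K HK] : forall n, exists K : R, 1 <= K /\
    forall X, S X -> tail_mean X K <= (4 ^+ n)^-1.
  move=> n; have [K0 HK0] : exists K0 : R, forall K X, K0 <= K -> S X ->
      tail_mean X K <= (4 ^+ n)^-1.
    by apply: ui; rewrite invr_gt0 exprn_gt0.
  exists (Num.max 1 K0); split; first by rewrite le_max lexx.
  by move=> X; apply: HK0; rewrite le_max lexx orbT.
have K0 n : 0 < K n by apply: lt_le_trans (HK n).1.
pose a n := (K n)^-1; pose c n : R := 4 ^+ n.
have a_gt0 n : 0 < a n by rewrite invr_gt0.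
have a0 n : 0 <= a n by exact: ltW.
have a1 n : a n <= 1 by rewrite invf_le1// (HK n).1.
have c1 n : 1 <= c n by rewrite exprn_ege1// ler1n.
exists (sup_oce a c); first by apply: sup_oce_calR.
(* [K 0 + 1] bounds E|X|, since the tail at level 0 is at most [4 ^ 0 = 1]. The 2 is [a n * K n = 1]
   plus the excess term, at most [4 ^ n / 4 ^ n]. *)
exists (K 0 + 1 + 2) => X SX.
have m_le : mean (fun w => `|X w|) <= K 0 + 1.
  by apply: mean_norm_le_tail; [exact: ltW|have := (HK 0).2 X SX;
    rewrite expr0 invr1].
have m0 : 0 <= mean (fun w => `|X w|) by exact: mean_ge0.
rewrite gee0_abs; last first.
  by apply: le_trans (sup_oce_ge_mean a0 a1 c1 _); rewrite lee_fin.
apply: sup_oce_le => n; rewrite lee_fin.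
apply: le_trans (oce_le_excess (a0 n) (a1 n) (c1 n) _ (K n)) _.
have iX := intg_norm (intgL1 X).
have excess : mean (fun w => Num.max (`|X w| - K n) 0) <= tail_mean X (K n).
  apply: mean_le => [||w]; [|exact: intg_tail|].
    by apply: intg_max0; apply: intgD => //; exact: intg_cst.
  rewrite indicE; case: (boolP (w \in _)) => [_|].
    by rewrite mulr1 ge_max normr_ge0 andbT gerBl ltW.
  rewrite notin_setE /= => /negP; rewrite -leNgt mulr0 => XK.
  by rewrite ge_max lexx andbT subr_le0.
have h1 : a n * K n = 1 by rewrite /a mulVf// gt_eqF.
have h2 : (1 - a n) * mean (fun w => `|X w|) <= mean (fun w => `|X w|).
  by rewrite ler_piMl// gerBl.
have h3 : c n * mean (fun w => Num.max (`|X w| - K n) 0) <= 1.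
  rewrite -[leRHS](@divff _ (c n)) ?gt_eqF ?(lt_le_trans _ (c1 n))//.
  apply: ler_wpM2l; first exact: le_trans (c1 n).
  by apply: le_trans excess _; exact: (HK n).2.
change (a n * K n + (1 - a n) * mean (fun w => `|X w|) +
  c n * mean (fun w => Num.max (`|X w| - K n) 0) <= K 0 + 1 + 2).
lra.
Qed.

(** Upper bounds come from monotonicity, as [X] and [- X] are below [|X|]; lower bounds from
    [0 = rho 0 <= rho X + rho (- X)]. *)
Lemma risk_abs_bounded rho S : calR rho ->
  bounded_over S (fun X => rho (L1_abs X)) ->
  bounded_over S rho /\ bounded_over S (fun X => rho (- X)).
Proof.
move=> [cr _ _ _] [M HM].
have le_abs X : (rho X <= rho (L1_abs X))%E.
  by apply: coherent_le => // w; exact: ler_norm.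
have leN_abs X : (rho (- X)%R <= rho (L1_abs X))%E.
  by apply: coherent_le => // w;
    rewrite L1_oppE -[leRHS]/`|X w| -normrN ler_norm.
have absM X : S X -> (rho (L1_abs X) <= M%:E)%E.
  by move=> /HM; apply: le_trans; exact: lee_abs.
have geN X : (- rho (- X)%R <= rho X)%E.
  have := coherent_subadd X (- X) cr; rewrite subrr coherent0//.
  have := rm_gtNy cr X; have := rm_gtNy cr (- X).
  case: (rho X) => [r| |]; case: (rho (- X)) => [s| |]//= _ _.
  - by rewrite -EFinD !lee_fin; lra.
  - by move=> _; rewrite leey.
have two Y : (rho Y <= M%:E)%E -> (rho (- Y)%R <= M%:E)%E ->
  (`|rho Y| <= M%:E)%E.
  move=> h1 h2; have : (- M%:E <= rho Y)%E.
    by apply: le_trans (geN Y); rewrite leeN2.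
  move: h1; case: (rho Y) => // r; rewrite -EFinN !lee_fin ler_norml => -> ->//.
split; exists M => X SX; apply: two; rewrite ?opprK.
- exact: le_trans (le_abs X) (absM X SX).
- exact: le_trans (leN_abs X) (absM X SX).
- exact: le_trans (leN_abs X) (absM X SX).
- exact: le_trans (le_abs X) (absM X SX).
Qed.

(** The tail of [|X|] is the sum of the right tails of [X] and [- X], each handled by [calR_tail].
    The lower bound on the mean needed for one tail is supplied by the risk measure controlling the
    other. *)
Lemma risk_bounded_above_ui rho rho' S : atomless P -> calR rho -> calR rho' ->
  bounded_above_over S rho -> bounded_above_over S (fun X => rho' (- X)) ->
  uniformly_integrable S.
Proof.
move=> hP rR rR' [M HM] [M' HM']; apply/uniformly_integrableP => e e0.
have e2 : 0 < e / 2 by exact: divr_gt0.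
have [K1 HK1] := calR_tail hP M M' rR e2.
have [K2 HK2] := calR_tail hP M' M rR' e2.
have meanNX X : mean (- X)%R = - mean X by rewrite -meanN//; exact: intgL1.
have mean_ge X : S X -> - M' <= mean X.
  move=> /HM'; case: rR' => cr lr lscr _.
  move=> /(le_trans (coherent_ge_mean hP (- X) cr lr lscr));
    rewrite lee_fin meanNX.
  lra.
have mean_leM X : S X -> mean X <= M.
  move=> /HM; case: rR => cr lr lscr _.
  by move=> /(le_trans (coherent_ge_mean hP X cr lr lscr)); rewrite lee_fin.
(* The 0 ensures [K >= 0], so that at each point at most one of the two tails is active. *)
exists (Num.max 0 (Num.max K1 K2)) => K X;
  rewrite !ge_max => /and3P[K0 K1K K2K] SX.
have h1 := HK1 K X K1K (HM X SX) (mean_ge X SX).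
have h2 : mean (fun w => (- X)%R w * \1_[set v | K < (- X)%R v] w) <= e / 2.
  by apply: HK2 => //; [exact: HM'|rewrite meanNX lerN2 mean_leM].
have mgt Y : measurable [set v | K < Y v] by apply: measurable_gt;
  exact: intg_meas (intgL1 Y).
rewrite [e]splitr; apply: le_trans (lerD h1 h2).
rewrite -meanD; [|by apply: intgM1 => //;
  exact: intgL1|by apply: intgM1 => //; exact: intgL1].
apply: mean_le => [||w]; first exact: intg_tail.
  by apply: intgD; apply: intgM1 => //; exact: intgL1.
rewrite !indic_gt L1_oppE.
have [x0|x0] := leP 0 (X w).
  rewrite ger0_norm// [K < - _]ltNge (le_trans _ K0) ?oppr_le0//=.
  by rewrite mulr0 addr0.
rewrite ltr0_norm// [K < X w]ltNge (le_trans (ltW x0))//=.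
by rewrite mulr0 add0r.
Qed.

End uniform_integrability.

Theorem theorem4p8 (d : measure_display) (T : measurableType d) (R : realType)
    (P : probability T R) (hP : atomless P) (S : set (L1 P)) :
  [<-> uniformly_integrable S;
       exists2 rho, calR rho & bounded_over S (fun X => rho (L1_abs X));
       exists2 rho, calR rho &
         bounded_over S rho /\ bounded_over S (fun X => rho (- X));
       exists rho rho', [/\ calR rho, calR rho', bounded_above_over S rho &
         bounded_above_over S (fun X => rho' (- X))]].
Proof.
tfae.
- exact: ui_risk_bounded.
- by move=> [rho rR bnd]; exists rho => //; exact: risk_abs_bounded.
- move=> [rho rR [[M HM] [M' HM']]]; exists rho, rho; split => //.
    by exists M => X SX; apply: le_trans (HM X SX); exact: lee_abs.
  by exists M' => X SX; apply: le_trans (HM' X SX); exact: lee_abs.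
- by move=> [rho [rho' [rR rR' b b']]];
  exact: (risk_bounded_above_ui hP rR rR').
Qed.
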